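(* Let $G$ be a cers. Then $G$ is normal if and only if $G$ is resonantly equivalent to a catacondensed benzenoid graph.
   Context: An even ring system is a simple bipartite 2-connected plane graph in which all interior vertices have degree 3 and all boundary vertices have degree 2 or 3. The inner dual has a vertex for each inner face, two vertices adjacent iff the faces share an edge; two inner faces are adjacent if they share an edge. A cers (catacondensed even ring system) is an even ring system whose inner dual is a tree. A catacondensed benzenoid graph is a cers all of whose inner faces are hexagons. For edges $e,f$ of a graph $G$, $d_G(e,f)$ denotes their distance in the line graph of $G$. If $F,F',F''$ are inner faces of a cers $G$ with $F,F'$ sharing edge $e$ and $F',F''$ sharing edge $f$, the triple $(F,F',F'')$ is regular if $d_G(e,f)$ is even and irregular otherwise. A cers $G$ is normal if (i) every inner face is adjacent to at most three other inner faces, and (ii) whenever an inner face $F$ is adjacent to three distinct inner faces $F_1,F_2,F_3$, all triples $(F_1,F,F_2)$, $(F_1,F,F_3)$, $(F_2,F,F_3)$ are regular. If $F$ is an inner face and $F_0$ the outer face of $G$, a connected component of the subgraph induced by $E(F)\cap E(F_0)$ is a boundary segment. Transformation 1: given a cers and a boundary segment $P$, subdivide edges of $P$ an even number of times in total, or conversely smooth an even number of (degree-2) vertices of $P$. Two cers are resonantly equivalent if one can be obtained from the other by successively applying Transformation 1. *)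

(* Defs.v *)
From Stdlib Require Export Relation_Operators.
From mathcomp Require Export all_boot all_fingroup.

Set Implicit Arguments.
Unset Strict Implicit.
Unset Printing Implicit Defensive.

(* Distance in a finite graph with adjacency relation r: the length of a      *)
(* shortest r-path from x to y (and the junk value #|T| if there is none).    *)
Definition gdist (T : finType) (r : rel T) (x y : T) : nat :=
  find (fun n => [exists p : n.-tuple T, path r x p && (last x p == y)])
       (iota 0 #|T|).

(* The graph on the vertex set S with (symmetric irreflexive) adjacency r.    *)
Definition is_tree (T : finType) (S : {set T}) (r : rel T) : Prop :=
  [/\ S != set0,
      {in S &, forall x y,
        connect [rel a b | [&& a \in S, b \in S & r a b]] x y}
    & forall c : seq T, {subset c <= S} -> ucycle r c -> size c <= 2].

(* A finite connected plane multigraph with at least one edge, given up to    *)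
(* orientation-preserving homeomorphism by its combinatorial map.  A dart is  *)
(* an edge together with one of its two directions; edge reverses a dart, and *)
(* node is the rotation of the darts around their common origin, so that      *)
(* d |-> node (edge d) walks along the boundary of the face on one fixed side *)
(* of d.  Vertices, edges and faces are the orbits of these permutations, and *)
(* planarity is Euler's formula V - E + F = 2.  The outer face is part of the *)
(* data.                                                                      *)
Record plane_graph := PlaneGraph {
  dart :> finType;
  edge : {perm dart};
  node : {perm dart};
  outer : {set dart};
  edgeK : involutive edge;
  edge_neq : forall d : dart, edge d != d;
  dart_connected : forall x y : dart,
    connect [rel a b | (b == edge a) || (b == node a)] x y;
  euler_formula :
    #|porbits node| + #|porbits (edge * node)%g| = #|porbits edge| + 2;
  outer_face : outer \in porbits (edge * node)%g
}.

Definition face (G : plane_graph) : {perm G} := (edge G * node G)%g.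

Definition vertices (G : plane_graph) : {set {set G}} := porbits (node G).
Definition edges (G : plane_graph) : {set {set G}} := porbits (edge G).
Definition faces (G : plane_graph) : {set {set G}} := porbits (face G).

Definition vertex_of (G : plane_graph) (d : G) : {set G} := porbit (node G) d.
Definition edge_of (G : plane_graph) (d : G) : {set G} := porbit (edge G) d.

Definition endpoints (G : plane_graph) (e : {set G}) : {set {set G}} :=
  [set vertex_of d | d in e].

Definition vertex_adj (G : plane_graph) : rel {set G} :=
  [rel u v | [exists d : G, (vertex_of d == u) && (vertex_of (edge G d) == v)]].

Definition line_adj (G : plane_graph) : rel {set G} :=
  [rel e f | [&& e \in edges G, f \in edges G, e != f
               & endpoints e :&: endpoints f != set0]].

Definition edge_dist (G : plane_graph) (e f : {set G}) : nat :=
  gdist (@line_adj G) e f.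

Definition simple_graph (G : plane_graph) : Prop :=
  (forall d : G, vertex_of (edge G d) != vertex_of d) /\
  (forall d d' : G, vertex_of d = vertex_of d' ->
     vertex_of (edge G d) = vertex_of (edge G d') -> d = d').

Definition bipartite (G : plane_graph) : Prop :=
  exists c : {set G} -> bool,
    forall d : G, c (vertex_of d) != c (vertex_of (edge G d)).

Definition two_connected (G : plane_graph) : Prop :=
  2 < #|vertices G| /\
  forall v, v \in vertices G ->
    {in vertices G :\ v &, forall x y,
      connect [rel a b | [&& a != v, b != v & vertex_adj a b]] x y}.

(* A vertex is the set of darts leaving it. *)
Definition degree (G : plane_graph) (v : {set G}) : nat := #|v|.

Definition boundary_vertex (G : plane_graph) (v : {set G}) : bool :=
  v :&: outer G != set0.

Definition even_ring_system (G : plane_graph) : Prop :=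
  [/\ simple_graph G, bipartite G, two_connected G
    & forall v, v \in vertices G ->
        if boundary_vertex v then (degree v == 2) || (degree v == 3)
        else degree v == 3].

Definition inner_faces (G : plane_graph) : {set {set G}} :=
  faces G :\ outer G.

Definition face_edges (G : plane_graph) (F : {set G}) : {set {set G}} :=
  [set edge_of d | d in F].

Definition inner_dual (G : plane_graph) : rel {set G} :=
  [rel F F' | [&& F \in inner_faces G, F' \in inner_faces G, F != F'
                & face_edges F :&: face_edges F' != set0]].

Definition cers (G : plane_graph) : Prop :=
  even_ring_system G /\ is_tree (inner_faces G) (@inner_dual G).

(* A face is the set of darts that it lies beside, one for each of its edges  *)
(* when the graph is 2-connected.                                             *)
Definition catacondensed_benzenoid (G : plane_graph) : Prop :=
  cers G /\ forall F, F \in inner_faces G -> #|F| = 6.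

(* In a cers two adjacent inner faces share exactly one edge. *)
Definition regular_triple (G : plane_graph) (F F' F'' : {set G}) : Prop :=
  forall e f : {set G},
    e \in face_edges F :&: face_edges F' ->
    f \in face_edges F' :&: face_edges F'' ->
    ~~ odd (edge_dist e f).

Definition normal_cers (G : plane_graph) : Prop :=
  (forall F, F \in inner_faces G -> #|[set F' | inner_dual F F']| <= 3) /\
  (forall F F1 F2 F3 : {set G},
     inner_dual F F1 -> inner_dual F F2 -> inner_dual F F3 ->
     F1 != F2 -> F1 != F3 -> F2 != F3 ->
     [/\ regular_triple F1 F F2, regular_triple F1 F F3
       & regular_triple F2 F F3]).

(* A boundary segment is represented by its set of edges. *)
Definition boundary_segment (G : plane_graph) (P : {set {set G}}) : Prop :=
  exists F e,
    let B := face_edges F :&: face_edges (outer G) in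
    [/\ F \in inner_faces G, e \in B
      & P = [set f | connect
               [rel a b | [&& a \in B, b \in B & line_adj a b]] e f]].

(* H is obtained from G by inserting a new vertex, with darts a and b, in the *)
(* middle of the edge carrying d; phi sends a dart of G to the dart of H with *)
(* the same origin and initial direction.                                     *)
Definition subdivision (G H : plane_graph) (d : G) (phi : G -> H) : Prop :=
  injective phi /\
  exists a b : H,
    [/\ a != b,
        forall y : H, (y \in codom phi) = (y != a) && (y != b),
        [/\ edge H (phi d) = a, edge H (phi (edge G d)) = b
          & forall x : G, x \notin edge_of d ->
              edge H (phi x) = phi (edge G x)],
        [/\ node H a = b, node H b = a
          & forall x : G, node H (phi x) = phi (node G x)]
      & forall x : G, (phi x \in outer H) = (x \in outer G)].

(* The set of edges of H covering the edges in P, for phi as above. *)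
Definition push_edges (G H : plane_graph) (phi : G -> H) (P : {set {set G}}) :
    {set {set H}} :=
  [set edge_of (phi x) | x in cover P].

(* subdivisions P n Q: H is obtained from G by n successive subdivisions of   *)
(* edges of P (including those created by earlier subdivisions), and Q is the *)
(* set of edges of H that P has become.                                       *)
Inductive subdivisions (G : plane_graph) (P : {set {set G}}) :
    nat -> forall H : plane_graph, {set {set H}} -> Prop :=
| Subdivisions0 : @subdivisions G P 0 G P
| SubdivisionsS n (H K : plane_graph) (Q : {set {set H}}) (d : H)
    (phi : H -> K) :
    @subdivisions G P n H Q -> edge_of d \in Q -> subdivision d phi ->
    @subdivisions G P n.+1 K (push_edges phi Q).

(* Smoothing a vertex of degree 2 is the converse of subdividing an edge: H   *)
(* arises from G by smoothing n vertices of Q when G arises from H by n       *)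
(* subdivisions that produce Q.                                               *)
Definition transformation1 (G H : plane_graph) : Prop :=
  (exists n (P : {set {set G}}) (Q : {set {set H}}),
     [/\ boundary_segment P, ~~ odd n & subdivisions P n Q]) \/
  (exists n (P : {set {set H}}) (Q : {set {set G}}),
     [/\ boundary_segment Q, ~~ odd n & subdivisions P n Q]).

Definition obtained_from (H G : plane_graph) : Prop :=
  clos_refl_trans plane_graph
    (fun A B => [/\ cers A, cers B & transformation1 A B]) G H.

Definition resonantly_equivalent (G H : plane_graph) : Prop :=
  obtained_from H G \/ obtained_from G H.

(* Main.v *)
(* Everything topological comes from one consequence of Euler's formula: a    *)
(* set of edges meeting every face boundary evenly is a cut.  It shows that   *)
(* an edge with the same face on both sides is a bridge, so that for degrees  *)
(* 2 and 3 being 2-connected means that there is no such edge; that two inner *)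
(* faces share at most one edge; and that for two shared edges e and f of an  *)
(* inner face a shortest walk from e to f stays on one side of the face.      *)
(* Hence in a 2-colouring the distance of e and f is even iff the darts of e  *)
(* and f along the face start at vertices of the same colour, and normality   *)
(* says that a face has at most three shared edges, starting at vertices of   *)
(* one colour if there are three.                                             *)
(*   Transformation 1 changes the relative colour of two vertices of a face   *)
(* only across the segment it acts on, and the rest of the face boundary is   *)
(* an arc, so normality is preserved in both directions.  In a hexagon no two *)
(* consecutive edges are shared, so benzenoids are normal.  Conversely, in a  *)
(* normal cers a face of size at most 4 has an unshared edge, which can be    *)
(* subdivided twice, and a face of size at least 8 has three consecutive      *)
(* unshared edges, which can be merged into one; iterating, all inner faces   *)
(* become hexagons.                                                           *)

(* The bridge from combinatorial maps to topology is [face_even_cut]. Over [F_2] the vertex-edge and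
   face-edge incidence matrices are orthogonal, connectedness bounds the corank of each by one, and
   Euler's formula then makes the cuts the whole orthogonal complement of the face boundaries. Every
   separation argument uses an explicit cut: a single edge ([bridge_cut]), two edges between the
   same two faces ([double_edge_cut], [chord_cut]), or all edges ([even_facesP]).

   Through [odd_edge_dist] and [normal_cersP], normality becomes a condition on the colours of
   shared darts within one face. For its invariance, 2-colourings of the two graphs are compared
   along a face: they differ by a constant as long as no subdivided edge is crossed, and by
   [segment_arc] two shared edges of a face are joined by an arc that avoids a given boundary
   segment. This gives [transformation1_normal], and with [benzenoid_normal] the backward
   implication.

   Forwards, [total_defect] measures how far the inner faces are from hexagons. Faces are even, so a
   face that is not a hexagon has size at most 4 or at least 8; [subdivide_step] and [smooth_step]
   then lower the defect. Normality supplies the three consecutive unshared edges of a large face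
   ([three_unshared]) and survives each step. *)
Require Import Defs.
From mathcomp Require Import all_algebra zify.

Set Implicit Arguments.
Unset Strict Implicit.
Unset Printing Implicit Defensive.

(** * Orbits of permutations *)

Section Orbits.
Variables (T : finType) (s : {perm T}).

Lemma porbit_step x : porbit s (s x) = porbit s x.
Proof. exact: (porbit_perm s 1 x). Qed.

Lemma porbit_iter i x : porbit s (iter i s x) = porbit s x.
Proof. by rewrite -permX porbit_perm. Qed.

Lemma porbit_in x y : (y \in porbit s x) = (porbit s y == porbit s x).
Proof. by rewrite eq_porbit_mem. Qed.

Lemma porbit_iterP x y :
  porbit s y = porbit s x -> exists2 i, i < #|porbit s x| & y = iter i s x.
Proof.
by move/eqP; rewrite -porbit_in porbit_traject => /trajectP.
Qed.

Lemma iter_porbit_inj x i j : i < #|porbit s x| -> j < #|porbit s x| ->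
  iter i s x = iter j s x -> i = j.
Proof.
move=> ltiN ltjN eq_ij; apply/eqP.
have/uniqP/(_ i j) := uniq_traject_porbit s x.
rewrite !inE size_traject => /(_ x ltiN ltjN) H; apply/eqP/H.
by rewrite !nth_traject.
Qed.

Lemma porbit_mem_porbits x : porbit s x \in porbits s.
Proof. by rewrite imset_f. Qed.

Lemma porbitsP O : reflect (exists x, O = porbit s x) (O \in porbits s).
Proof.
by apply: (iffP imsetP) => [[x _ ->]|[x ->]]; exists x.
Qed.

Lemma porbits_porbit O x : O \in porbits s -> (x \in O) = (porbit s x == O).
Proof. by case/porbitsP=> y ->; rewrite porbit_in. Qed.

Lemma porbit_fun_const (U : Type) (g : T -> U) :
  (forall x, g (s x) = g x) -> forall x y, porbit s x = porbit s y -> g x = g y.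
Proof.
move=> gs x y /porbit_iterP[i _ ->]; elim: i => //= i IH; by rewrite gs.
Qed.

End Orbits.

Lemma porbit_involutive (T : finType) (e : {perm T}) x : involutive e ->
  porbit e x = [set x; e x].
Proof.
move=> eK; apply/setP=> y; rewrite !inE; apply/porbitP/orP => [[i ->]|].
  elim: i => [|i]; first by left; rewrite perm1.
  rewrite expgSr permM => -[/eqP->|/eqP->]; first by right.
  by left; rewrite eK.
by case=> /eqP->; [exists 0; rewrite perm1 | exists 1; rewrite expg1].
Qed.

(** * Cuts of a plane graph *)

Section Cohomology.
Variable G : plane_graph.
Implicit Types x y z d : G.

Lemma face_edge x : face G (edge G x) = node G x.
Proof. by rewrite permM edgeK. Qed.

Lemma faceE x : face G x = node G (edge G x).
Proof. by rewrite permM. Qed.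

Lemma edge_ofE x : edge_of x = [set x; edge G x].
Proof. exact: porbit_involutive (@edgeK G). Qed.

Lemma edge_inj : injective (edge G). Proof. exact: perm_inj. Qed.

Lemma dart_const (U : Type) (g : G -> U) :
  (forall x, g (edge G x) = g x) -> (forall x, g (node G x) = g x) ->
  forall x y, g x = g y.
Proof.
move=> ge gn x y; have /connectP[p] := dart_connected x y.
elim: p x => [|z p IH] x /=; first by move=> _ ->.
by move=> /andP[/orP[]/eqP-> pth] /(IH _ pth) <-; rewrite ?ge ?gn.
Qed.

Local Open Scope ring_scope.
Import GRing.Theory.

Local Notation F2 := 'F_2.

Lemma F2_addxx (a : F2) : a + a = 0.
Proof. by case: a => [[|[|]]] //= i; apply/val_inj. Qed.

(** Common darts are counted modulo 2: an edge contributes to the two orbits that contain its darts,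
    and nothing if both darts lie in one orbit. The same matrix serves vertices and faces. *)
Let incid (O : {set {set G}}) : 'M[F2]_(#|O|, #|edges G|) :=
  \matrix_(i, j) (#|enum_val i :&: enum_val j|)%:R.

Let sum_porbits (s : {perm G}) (f : {set G} -> F2) (A : {set G}) :
  \sum_(O in porbits s) f O * (#|O :&: A|)%:R = \sum_(d in A) f (porbit s d).
Proof.
rewrite (partition_big (porbit s) (mem (porbits s))) /=; last first.
  by move=> d _; apply: porbit_mem_porbits.
apply: eq_bigr => O OP; rewrite (eq_bigr (fun _ => f O)); last first.
  by move=> d /andP[_ /eqP->].
rewrite sumr_const mulr_natr; congr (_ *+ _); apply: eq_card => d.
by rewrite !inE (porbits_porbit _ OP) andbC.
Qed.

Let edge_sum (f : G -> F2) x :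
  \sum_(d in edge_of x) f d = f x + f (edge G x).
Proof.
by rewrite edge_ofE big_setU1 ?big_set1 // inE eq_sym edge_neq.
Qed.

Let row_fun (O : {set {set G}}) (O0 : {set G}) (hO : O0 \in O)
    (u : 'rV[F2]_#|O|) (o : {set G}) : F2 := u 0 (enum_rank_in hO o).

Let row_funE (O : {set {set G}}) (O0 : {set G}) (hO : O0 \in O)
    (u : 'rV[F2]_#|O|) k : u 0 k = row_fun hO u (enum_val k).
Proof. by rewrite /row_fun enum_valK_in. Qed.

Let mul_incid (s : {perm G}) (O0 : {set G}) (hO : O0 \in porbits s)
    (u : 'rV[F2]_#|porbits s|) x
    (k := enum_rank_in (porbit_mem_porbits (edge G) x) (edge_of x)) :
  (u *m incid (porbits s)) 0 k =
  row_fun hO u (porbit s x) + row_fun hO u (porbit s (edge G x)).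
Proof.
rewrite mxE; under eq_bigr => i _ do
  rewrite mxE (row_funE hO) enum_rankK_in ?porbit_mem_porbits //.
rewrite -(big_enum_val (fun o => row_fun hO u o * #|o :&: edge_of x|%:R)).
by rewrite sum_porbits (edge_sum (fun x => row_fun hO u (porbit s x))).
Qed.

(** A row vector in the kernel is a function on orbits that takes equal values at the two darts of
    each edge. Connectedness makes it constant, so the kernel has rank at most one. *)
Let rank_incid (s : {perm G}) :
  (forall (U : Type) (g : G -> U), (forall x, g (edge G x) = g x) ->
     (forall x, g (s x) = g x) -> forall x y, g x = g y) ->
  (#|porbits s| <= (\rank (incid (porbits s))).+1)%N.
Proof.
move=> conn; set A := incid _.
suff: (\rank (kermx A) <= 1)%N by rewrite mxrank_ker leq_subLR addn1.
apply: leq_trans (rank_leq_row (const_mx 1 : 'rV[F2]_#|porbits s|)).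
apply: mxrankS; apply/row_subP => i.
set u := row i _; have uA : u *m A = 0 by apply/sub_kermxP; apply: row_sub.
clearbody u; have [O0 hO] : exists O0, O0 \in porbits s.
  by exists (enum_val i); apply: enum_valP.
pose g x := row_fun hO u (porbit s x).
have ge x : g (edge G x) = g x.
  have := mul_incid hO u x; rewrite /= uA mxE -/(g x) -/(g (edge G x)) => /esym E.
  by rewrite -[LHS](addKr (g x)) E addr0 -[LHS]addr0 -(F2_addxx (g x)) addKr.
have gs x : g (s x) = g x by rewrite /g porbit_step.
suff -> : u = u 0 i *: const_mx 1 by rewrite scalemx_sub.
apply/rowP => k; rewrite !mxE mulr1 !(row_funE hO).
have /porbitsP[x ->] := enum_valP k; have /porbitsP[y ->] := enum_valP i.
exact: (conn _ g).
Qed.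

(** The darts [edge G d] and [node G d] lie on the same face. Hence, around a vertex, the indicator
    of a face has the same sum over the darts as over their reverses, up to a shift by [node], and
    the two sums cancel modulo 2. *)
Let incid_orth : incid (vertices G) *m (incid (faces G))^T = 0.
Proof.
apply/matrixP => i k; rewrite !mxE.
under eq_bigr => j _ do rewrite !mxE.
set v := enum_val i; set f := enum_val k.
rewrite -(big_enum_val (fun e : {set G} => #|v :&: e|%:R * #|f :&: e|%:R)).
under eq_bigr => e _ do rewrite (setIC v) mulrC.
rewrite sum_porbits.
pose h d : F2 := (d \in f)%:R.
have -> : \sum_(d in v) (#|f :&: porbit (edge G) d|%:R : F2) =
          \sum_(d in v) (h d + h (edge G d)).
  apply: eq_bigr => d _; rewrite -(edge_sum h) -sum1_card natr_sum /=.
  rewrite [RHS](bigID (mem f)) /= [X in _ + X]big1 ?addr0; last first.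
    by move=> x /andP[_ /negPf xf]; rewrite /h xf.
  apply: eq_big => [x|x]; first by rewrite inE andbC.
  by rewrite inE /h => /andP[->].
have hface d : h (edge G d) = h (node G d).
  rewrite /h -face_edge !(porbits_porbit _ (enum_valP k)).
  by rewrite -/(face G) porbit_step.
under eq_bigr do rewrite hface.
rewrite big_split /= (reindex_inj (@perm_inj _ (node G))) /=.
rewrite (eq_bigl (mem v)) ?F2_addxx //.
by move=> d /=; rewrite !(porbits_porbit _ (enum_valP i)) porbit_step.
Qed.

Lemma face_const (U : Type) (g : G -> U) :
  (forall x, g (edge G x) = g x) -> (forall x, g (face G x) = g x) ->
  forall x y, g x = g y.
Proof.
move=> ge gf; apply: dart_const => // x.
by rewrite -face_edge gf ge.
Qed.

(* Cuts are orthogonal to face boundaries over F_2; by Euler's formula the    *)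
(* ranks of the incidence matrices leave no room for anything else.           *)
Lemma face_even_cut (x : G -> bool) :
  (forall d, x (edge G d) = x d) ->
  (forall d, ~~ odd #|[set z in porbit (face G) d | x z]|) ->
  exists2 g : G -> bool, forall d, g (node G d) = g d
                       & forall d, g d (+) g (edge G d) = x d.
Proof.
move=> xe xf.
pose A := incid (vertices G); pose B := incid (faces G).
have rA : (#|vertices G| <= (\rank A).+1)%N by apply: rank_incid dart_const.
have rB : (#|faces G| <= (\rank B).+1)%N by apply: rank_incid face_const.
have sub : (A <= kermx B^T)%MS by apply/sub_kermxP; apply: incid_orth.
(* Euler's formula reads (|V| - 1) + (|F| - 1) = |E|, so the rank |E| - rank [B] of this kernel is
   at most the rank of [A], and the inclusion [sub] is an equality. *)
have eqAB : (kermx B^T <= A)%MS.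
  rewrite -(geq_leqif (mxrank_leqif_sup sub)) mxrank_ker mxrank_tr leq_subLR.
  have := euler_formula G; rewrite -/(vertices G) -/(face G) -/(faces G) -/(edges G).
  move: rA rB; move: (\rank A) (\rank B) => a b ha hb e.
  have: (#|edges G| + 2 <= a.+1 + b.+1)%N by rewrite -e leq_add.
  by rewrite addSn !addnS addn0 !ltnS addnC.
pose w : 'rV[F2]_#|edges G| := 
  \row_j [exists d in (enum_val j : {set G}), x d]%:R.
have wE d (k := enum_rank_in (porbit_mem_porbits (edge G) d) (edge_of d)) :
    w 0 k = (x d)%:R.
  rewrite mxE enum_rankK_in ?porbit_mem_porbits //.
  suff -> : [exists z in edge_of d, x z] = x d by [].
  apply/existsP/idP => [[z]|xd]; last by exists d; rewrite porbit_id.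
  by rewrite edge_ofE !inE => /andP[/orP[]/eqP->]; rewrite ?xe.
(* The indicator row of [x] is a combination of vertex rows; its coefficients [u] label the vertices
   by the side of the cut. *)
have /submxP[u wu] : (w <= A)%MS.
  apply: submx_trans eqAB; apply/sub_kermxP/rowP => k; rewrite !mxE.
  have /porbitsP[d fd] := enum_valP k.
  have hE : edge_of d \in edges G by apply: porbit_mem_porbits.
  under eq_bigr => j _ do rewrite (row_funE hE) [(_^T) _ _]mxE [B _ _]mxE setIC.
  rewrite -(big_enum_val
    (fun e : {set G} => row_fun hE w e * #|e :&: enum_val k|%:R)).
  rewrite sum_porbits fd.
  have -> : \sum_(z in porbit (face G) d) row_fun hE w (porbit (edge G) z) =
            \sum_(z in porbit (face G) d) ((x z)%:R : F2).
    apply: eq_bigr => z _; rewrite -wE (row_funE hE) enum_rankK_in //.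
    exact: porbit_mem_porbits.
  rewrite -natr_sum -big_mkcondr /= sum1_card.
  have := xf d; rewrite (_ : #|[set _ in _ | _]| =
    #|[pred z in porbit (face G) d | x z]|); last first.
    by apply: eq_card => z; rewrite !inE.
  rewrite cardE; move: (size _) => n hn.
  by rewrite -(odd_double_half n) (negPf hn) add0n -addnn natrD F2_addxx.
have [x0|G0] := pickP (fun d : G => true); last first.
  by exists (fun _ => false) => d; have := G0 d.
have hO := porbit_mem_porbits (node G) x0.
exists (fun d => row_fun hO u (vertex_of d) == 1).
  by move=> d; rewrite /vertex_of porbit_step.
move=> d; have := mul_incid hO u d; rewrite /= -/A -wu wE.
rewrite -/(vertex_of _) -/(vertex_of (edge G d)).
move: (row_fun _ _ _) (row_fun _ _ _) => a b.
by move: a b (x d) => [[|[|a]] ha] [[|[|b]] hb] [] //= /eqP.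
Qed.
End Cohomology.

Lemma odd_card_sep (T : finType) (A : {set T}) (P : pred T) :
  odd #|[set z in A | P z]| = \big[addb/false]_(z in A) P z.
Proof.
rewrite -sum1_card (eq_bigl (fun z => (z \in A) && P z)).
  rewrite big_mkcondr (big_morph odd oddD (erefl _)).
  by apply: eq_bigr => z _; case: (P z).
by move=> z; rewrite inE.
Qed.

Lemma odd_card_count_mem (T : finType) (A : {set T}) (l : seq T) :
  odd #|[set z in A | odd (count_mem z l)]| = odd (count (mem A) l).
Proof.
rewrite odd_card_sep; elim: l => [|a l IH] /=; first by rewrite big1.
under eq_bigr do rewrite oddD oddb.
rewrite big_split /= IH oddD oddb; congr (_ (+) _).
case: (boolP (a \in A)) => aA; last first.
  by apply: big1 => z zA; apply/negbTE; apply: contraNneq aA => ->.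
by rewrite (bigD1 a) //= eqxx big1 // => z /andP[_ /negPf za]; rewrite eq_sym.
Qed.

(** * Faces, shared darts and small cuts *)

Section DartConditions.
Variable G : plane_graph.
Implicit Types x y z d : G.

Definition face_of d : {set G} := porbit (face G) d.

Definition bridgeless := forall d, face_of (edge G d) != face_of d.

(* The degree condition of an even ring system, in terms of node. *)
Definition degree23 := forall d, node G d != d /\
  (node G (node G d) = d /\ ((d \in outer G) || (node G d \in outer G)) \/
   node G (node G (node G d)) = d).

(** The consequence of the inner dual being a tree on which the local arguments rest. *)
Definition dual_triangle_free := forall A B C : {set G},
  inner_dual A B -> inner_dual B C -> inner_dual C A -> False.

Definition dart_coloring (c : G -> bool) :=
  (forall d, c (node G d) = c d) /\ (forall d, c (edge G d) = ~~ c d).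

(* If there are no bridges, these are the darts between two inner faces. *)
Definition shared d := (d \notin outer G) && (edge G d \notin outer G).

Lemma outerE d : (d \in outer G) = (face_of d == outer G).
Proof. exact: (porbits_porbit _ (outer_face G)). Qed.

Lemma face_of_face d : face_of (face G d) = face_of d.
Proof. exact: porbit_step. Qed.

Lemma face_of_node d : face_of (node G d) = face_of (edge G d).
Proof. by rewrite -face_edge face_of_face. Qed.

Lemma face_of_iter i d : face_of (iter i (face G) d) = face_of d.
Proof. exact: porbit_iter. Qed.

Lemma outer_of d d' : face_of d = face_of d' -> (d \in outer G) = (d' \in outer G).
Proof. by rewrite !outerE => ->. Qed.

Lemma outer_face_dart d : (face G d \in outer G) = (d \in outer G).
Proof. by apply: outer_of; apply: face_of_face. Qed.

Lemma vertex_of_node d : vertex_of (node G d) = vertex_of d.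
Proof. exact: porbit_step. Qed.

Lemma vertex_of_face d : vertex_of (face G d) = vertex_of (edge G d).
Proof. by rewrite faceE vertex_of_node. Qed.

Lemma shared_edge d : shared (edge G d) = shared d.
Proof. by rewrite /shared edgeK andbC. Qed.

Lemma edge_of_edge d : edge_of (edge G d) = edge_of d.
Proof. exact: porbit_step. Qed.

Lemma edge_of_inj d d' : edge_of d = edge_of d' -> d' = d \/ d' = edge G d.
Proof.
move=> E; have: d' \in edge_of d by rewrite E porbit_id.
by rewrite edge_ofE !inE => /orP[]/eqP; [left|right].
Qed.

Lemma face_edge_of_inj : bridgeless -> forall d d',
  face_of d = face_of d' -> edge_of d = edge_of d' -> d = d'.
Proof.
move=> bl d d' fdd /edge_of_inj[//|E].
by have := bl d; rewrite -E -fdd eqxx.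
Qed.

(** Listing darts with multiplicity modulo 2 allows the edges of the list to coincide, so that the
    two-edge cuts need no distinctness. *)
Lemma cut_of_seq (l : seq G) :
  (forall d, odd (count_mem (edge G d) l) = odd (count_mem d l)) ->
  (forall d, ~~ odd (count (mem (face_of d)) l)) ->
  exists2 g : G -> bool, forall d, g (node G d) = g d
                       & forall d, g d (+) g (edge G d) = odd (count_mem d l).
Proof.
move=> le lf; apply: face_even_cut => // d.
by rewrite odd_card_count_mem.
Qed.

Lemma edge_eq d d' : (edge G d == d') = (d == edge G d').
Proof. exact/(can2_eq (@edgeK G) (@edgeK G)). Qed.

(** Both darts of the edge lie on one face, so every face meets the edge in zero or two darts. *)
Lemma bridge_cut d : face_of (edge G d) = face_of d ->
  exists2 g : G -> bool, forall z, g (node G z) = g z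
    & forall z, g z (+) g (edge G z) = (z == d) || (z == edge G d).
Proof.
move=> fd; have [|z|g gn gx] := @cut_of_seq [:: d; edge G d].
- move=> z /=; rewrite (inj_eq (@edge_inj G)) !addn0 addnC.
  by congr (odd (_ + _)); rewrite eq_sym edge_eq eq_sym.
- have: (d \in face_of z) = (edge G d \in face_of z).
    by rewrite !porbit_in -!/(face_of _) fd.
  by rewrite /= => ->; case: (_ \in _).
exists g => // z; rewrite gx /= addn0 ![_ == z]eq_sym.
case: eqP => [->|_] /=; last by rewrite oddb.
by rewrite eq_sym (negPf (edge_neq d)).
Qed.

Lemma double_edge_cut d d' : face_of d' = face_of d ->
  face_of (edge G d') = face_of (edge G d) ->
  exists2 g : G -> bool, forall z, g (node G z) = g z
    & forall z, g z (+) g (edge G z) =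
        ((z == d) || (z == edge G d)) (+) ((z == d') || (z == edge G d')).
Proof.
move=> fd fed; have [|z|g gn gx] := @cut_of_seq [:: d; edge G d; d'; edge G d'].
- move=> z /=; rewrite !(inj_eq (@edge_inj G)) !addn0.
  rewrite ![_ == edge G z]eq_sym !edge_eq !oddD !oddb ![_ == z]eq_sym.
  rewrite -[d == edge G z]edge_eq -[d' == edge G z]edge_eq ![edge G _ == z]eq_sym.
  by do 4![case: (z == _)].
- rewrite /= !porbit_in -!/(face_of _) fd fed !oddD !oddb.
  by case: (_ == _); case: (_ == _).
exists g => // z; rewrite gx /= addn0 ![_ == z]eq_sym !oddD !oddb addbA.
have orE a : (z == a) || (z == edge G a) = (z == a) (+) (z == edge G a).
  by case: eqP => [->|//]; rewrite eq_sym (negPf (edge_neq a)).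
by rewrite !orE addbA.
Qed.

(** As [face G z = node G (edge G z)], a face walk changes sides only by stepping over an edge of
    the cut. From [face G b] to the [m]-th dart, the edges stepped over are those with index
    strictly between 0 and [m]. *)
Lemma cut_arc (g : G -> bool) b m :
  (forall z, g (node G z) = g z) -> 0 < m ->
  (forall i, 0 < i < m -> g (edge G (iter i (face G) b)) = g (iter i (face G) b)) ->
  g (iter m (face G) b) = g (face G b).
Proof.
move=> gn; case: m => // m _; elim: m => // m IH h.
rewrite iterS faceE gn h ?ltnSn // IH // => i /andP[i0 im].
by rewrite h // i0 ltnW.
Qed.

Lemma cut_const_face (g : G -> bool) (O : {set G}) :
  (forall z, g (node G z) = g z) ->
  (forall z, face_of z = O -> g (edge G z) = g z) ->
  forall z z', face_of z = O -> face_of z' = O -> g z = g z'.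
Proof.
move=> gn ge z z' zO; rewrite -zO => /porbit_iterP[i _ ->].
elim: i => //= i ->; rewrite faceE gn ge //.
by rewrite face_of_iter.
Qed.

(** A cut contained in one edge is empty: the face walk from [face G z0] back to [z0] does not step
    over that edge, because its reverse dart lies on another face. *)
Lemma bridgeless_cut_const (g : G -> bool) z0 : bridgeless ->
  (forall z, g (node G z) = g z) ->
  (forall z, z != z0 -> z != edge G z0 -> g (edge G z) = g z) ->
  forall x y, g x = g y.
Proof.
move=> bl gn ge; suff gz : g (edge G z0) = g z0.
  apply: dart_const => // z.
  have [->|z1] := eqVneq z z0; first by [].
  have [->|z2] := eqVneq z (edge G z0); first by rewrite edgeK.
  exact: ge.
rewrite -[LHS]gn -faceE -[in RHS](iter_porbit (face G) z0).
symmetry; apply: cut_arc => //; first by rewrite lt0n card_porbit_neq0.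
move=> i /andP[i0 iN]; apply: ge.
  apply: contraTneq i0 => E; rewrite -leqNgt leqn0; apply/eqP.
  by apply: (@iter_porbit_inj _ (face G) z0 i 0) => //; rewrite lt0n card_porbit_neq0.
by apply: contra_neq (bl z0) => <-; rewrite face_of_iter.
Qed.

Lemma degree23_cases d d' : degree23 -> vertex_of d' = vertex_of d ->
  [\/ d' = d, d' = node G d | d = node G d'].
Proof.
move=> deg /porbit_iterP[i _ ->]; elim: i => [|i]; first by constructor 1.
case: (deg d) => _ [[n2 _]|n3]; rewrite iterS.
  case=> [->|->|E]; [by constructor 2|by constructor 1; rewrite n2|].
  by constructor 1.
case=> [->|->|E]; [by constructor 2| by constructor 3; rewrite n3|].
by constructor 1.
Qed.

(** Two distinct darts at a vertex of degree at most 3 are consecutive under [node], and [node G d]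
    lies on the face of [edge G d], which is not that of [d]. So a face visits each vertex only
    once. *)
Lemma face_vertex_inj : bridgeless -> degree23 -> forall d d',
  face_of d = face_of d' -> vertex_of d = vertex_of d' -> d = d'.
Proof.
move=> bl deg d d' fd vd; have [//|E|E] := degree23_cases deg vd.
  by have := bl d'; rewrite -face_of_node -E fd eqxx.
by have := bl d; rewrite -face_of_node -E fd eqxx.
Qed.

Definition at_vertex (g : G -> bool) (v : {set G}) := [exists z in v, g z].

Lemma at_vertexE (g : G -> bool) : (forall z, g (node G z) = g z) ->
  forall z, at_vertex g (vertex_of z) = g z.
Proof.
move=> gn z.
apply/existsP/idP => [[x /andP[xz]]|gz]; last by exists z; rewrite porbit_id.
by rewrite (porbit_fun_const gn (x:=x) (y:=z)) //; apply/eqP; rewrite -porbit_in.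
Qed.

Lemma inner_facesE d : (face_of d \in inner_faces G) = (d \notin outer G).
Proof. by rewrite !inE porbit_mem_porbits andbT outerE. Qed.

Lemma inner_facesP F :
  reflect (exists2 d, d \notin outer G & F = face_of d) (F \in inner_faces G).
Proof.
apply: (iffP idP) => [|[d dO ->]]; last by rewrite inner_facesE.
by move=> h; have := h; rewrite inE => /andP[_ /porbitsP[d E]];
  exists d => //; rewrite -inner_facesE /face_of -E.
Qed.

Lemma face_edgesP F e : F \in faces G ->
  reflect (exists2 d, face_of d = F & e = edge_of d) (e \in face_edges F).
Proof.
move=> FF; apply: (iffP imsetP) => -[d dF ->]; exists d => //.
  by apply/eqP; rewrite -(porbits_porbit _ FF).
by rewrite (porbits_porbit _ FF) -/(face_of d) dF.
Qed.

Lemma inner_dualP F F' : reflect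
  (exists d, [/\ shared d, F = face_of d, F' = face_of (edge G d) & F != F'])
  (inner_dual F F').
Proof.
apply: (iffP and4P) => [[FI FI' FF' /set0Pn[e]]|[d [sh -> -> ff]]].
  rewrite inE; case/inner_facesP: FI FF' => d dO ->; case/inner_facesP: FI' => d' dO' -> FF'.
  case/andP => /(face_edgesP _ (porbit_mem_porbits _ _)) [a fa ->].
  move=> /(face_edgesP _ (porbit_mem_porbits _ _)) [b fb /edge_of_inj[] E].
    by move: FF'; rewrite -[face_of d]fa -[face_of d']fb E eqxx.
  exists a; rewrite -E [face_of b]fb [face_of a]fa; split=> //.
  by rewrite /shared -E (outer_of fa) (outer_of fb) dO dO'.
case/andP: sh => dO edO; rewrite !inner_facesE dO edO ff; split=> //.
apply/set0Pn; exists (edge_of d); rewrite inE.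
apply/andP; split; apply/face_edgesP; rewrite ?porbit_mem_porbits //; first by exists d.
by exists (edge G d); rewrite ?edge_of_edge.
Qed.

Lemma shared_inner_dual d : bridgeless -> shared d ->
  inner_dual (face_of d) (face_of (edge G d)).
Proof.
by move=> bl sh; apply/inner_dualP; exists d; split; rewrite // eq_sym.
Qed.

End DartConditions.

(** * Edges between inner faces *)

Section SharedEdges.
Variable G : plane_graph.
Implicit Types x y z d : G.
Hypothesis bl : bridgeless G.
Hypothesis deg : degree23 G.
Hypothesis tri : dual_triangle_free G.

(* Otherwise the three faces at the common vertex would be pairwise adjacent. *)
Lemma shared_face x : shared x -> ~~ shared (face G x).
Proof.
move=> shx; apply/negP => shfx; have [xO exO] := andP shx.
have [fxO efxO] := andP shfx.
have E : face G x = node G (edge G x) := faceE x.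
have [_ [[n2 /orP[]]|n3]] := deg (edge G x).
- by rewrite (negPf exO).
- by rewrite -faceE (negPf fxO).
rewrite -E in n3; set r := node G (face G x) in n3.
have fr : face_of r = face_of (edge G (face G x)) by apply: face_of_node.
have fer : face_of (edge G r) = face_of (edge G x) by rewrite -face_of_node n3.
have shr : shared r by rewrite /shared (outer_of fr) (outer_of fer) efxO exO.
have sym d : shared d -> inner_dual (face_of (edge G d)) (face_of d).
  move=> sh; rewrite -[in X in inner_dual _ X](edgeK d).
  by apply: shared_inner_dual; rewrite ?shared_edge.
apply: (tri (A := face_of x) (B := face_of (edge G x)) (C := face_of r)).
- exact: shared_inner_dual.
- by rewrite -fer; apply: sym.
- by rewrite fr -(face_of_face x); apply: sym.
Qed.

Lemma outer_after_shared x : shared x -> edge G (face G x) \in outer G.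
Proof.
move=> sh; have := shared_face sh; have [xO _] := andP sh.
by rewrite /shared outer_face_dart xO /= negbK.
Qed.

Lemma outer_before_shared x : shared (face G x) -> edge G x \in outer G.
Proof.
move=> sh; have [] := andP sh; rewrite outer_face_dart => xO _.
apply: contraLR sh => exO; apply: shared_face.
by rewrite /shared xO exO.
Qed.

(* A second common edge would yield a 2-edge cut separating the ends of the   *)
(* first one, although the outer face reaches both ends without crossing it.  *)
Lemma shared_unique x y : shared x -> face_of y = face_of x ->
  face_of (edge G y) = face_of (edge G x) -> y = x.
Proof.
move=> sh fy fey; apply/eqP; case: (eqVneq y x) => // yx.
have [g gn gx] := double_edge_cut fy fey.
have [xO exO] := andP sh.
have gO z : face_of z = outer G -> g (edge G z) = g z.
  move=> zO; have zO' : z \in outer G by rewrite outerE zO.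
  apply/eqP; rewrite eq_sym -[_ == _]negbK -negb_add negbK gx.
  have nz w : w \notin outer G -> (z == w) = false.
    by move=> wO; apply/negbTE; apply: contraNneq wO => <-.
  by rewrite !nz // ?(outer_of fy) ?(outer_of fey).
have neq : g x (+) g (edge G x).
  rewrite gx eqxx /= [x == y]eq_sym (negPf yx) /=; apply/negP => /eqP E.
  by have := bl y; rewrite -E fy eqxx.
pose h := (face G)^-1%g x; have hx : face G h = x by rewrite permKV.
have hO : edge G h \in outer G by apply: outer_before_shared; rewrite hx.
have kO : face G (edge G (face G x)) \in outer G.
  by rewrite outer_face_dart outer_after_shared.
have: g (edge G h) = g (face G (edge G (face G x))).
  by apply: (cut_const_face gn gO); apply/eqP; rewrite -outerE.
rewrite face_edge !gn faceE gn => E.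
have gh : g (edge G h) = g x by rewrite -hx faceE gn.
by rewrite -gh E addbb in neq.
Qed.

Lemma face_edges_shared x e : shared x -> 
  e \in face_edges (face_of x) :&: face_edges (face_of (edge G x)) -> e = edge_of x.
Proof.
move=> sh; rewrite inE => /andP[].
move/(face_edgesP _ (porbit_mem_porbits _ _)) => [a fa ->].
move/(face_edgesP _ (porbit_mem_porbits _ _)) => [b fb /edge_of_inj[] E].
  have := bl x; rewrite -[face_of x]fa -[face_of (edge G x)]fb E.
  by rewrite eqxx.
by congr edge_of; apply: shared_unique => //; rewrite -E.
Qed.

End SharedEdges.

(** * The conditions on a cers in terms of darts *)

Section Characterization.
Variable G : plane_graph.
Implicit Types x y z d : G.

Lemma bipartiteP : bipartite G <-> exists c : G -> bool, dart_coloring c.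
Proof.
split=> [[c hc]|[c [cn ce]]].
  exists (fun d => c (vertex_of d)); split=> d; first by rewrite vertex_of_node.
  by have := hc d; case: (c _); case: (c _).
exists (at_vertex c) => d.
by rewrite !at_vertexE // ce; case: (c d).
Qed.

Lemma coloring_face (c : G -> bool) : dart_coloring c ->
  forall d, c (face G d) = ~~ c d.
Proof. by move=> [cn ce] d; rewrite faceE cn ce. Qed.

Lemma coloring_iter_face (c : G -> bool) : dart_coloring c ->
  forall i d, c (iter i (face G) d) = odd i (+) c d.
Proof.
move=> hc i d; elim: i => //= i IH.
by rewrite (coloring_face hc) IH addNb.
Qed.

Definition even_faces := forall d, ~~ odd #|face_of d|.

(** Forwards, [face_even_cut] applies to the set of all edges, and a cut containing every edge is a
    2-colouring. Backwards, the colour alternates along a face and returns after its full length. *)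
Lemma even_facesP : even_faces <-> exists c : G -> bool, dart_coloring c.
Proof.
split=> [ev|[c hc] d].
  have [//|d|g gn gx] := @face_even_cut G xpredT.
    by rewrite (_ : [set _ in _ | _] = face_of d) //; apply/setP => z; rewrite inE andbT.
  exists g; split=> // d; have := gx d; by case: (g d); case: (g _).
have := coloring_iter_face hc #|face_of d| d.
by rewrite iter_porbit; case: (c d); case: odd.
Qed.

Lemma card_vertex_le3 d : (#|vertex_of d| == 2) || (#|vertex_of d| == 3) ->
  node G d != d /\
    (#|vertex_of d| = 2 /\ node G (node G d) = d \/
     #|vertex_of d| = 3 /\ node G (node G (node G d)) = d).
Proof.
have inj := @iter_porbit_inj _ (node G) d; have it := iter_porbit (node G) d.
rewrite -/(vertex_of d) in inj it.
move=> h; split.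
  apply/eqP => nd; have /= := inj 1 0; case/orP: h => /eqP->; by move=> /(_ isT isT nd).
by case/orP: h it => /eqP-> /= it; [left|right].
Qed.

Lemma degree23P :
  (forall v, v \in vertices G ->
        if boundary_vertex v then (degree v == 2) || (degree v == 3)
        else degree v == 3) <-> degree23 G.
Proof.
split=> [hd d|deg _ /porbitsP[d ->]].
  have := hd _ (porbit_mem_porbits (node G) d); rewrite -/(vertex_of d) /degree.
  case: ifP => [bd h|_ h].
    have [nd [[v2 n2]|[_ n3]]] := card_vertex_le3 h; split=> //; last by right.
    left; split=> //; case/set0Pn: bd => z; rewrite inE => /andP[].
    rewrite porbit_in => /eqP /porbit_iterP[i]; rewrite -/(vertex_of d) v2.
    by case: i => [|[|//]] _ -> /= ->; rewrite ?orbT.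
  have [|nd [[v2 _]|[_ n3]]] := @card_vertex_le3 d; first by rewrite h orbT.
    by rewrite v2 in h.
  by split=> //; right.
rewrite -/(vertex_of d) /degree; have [nd [[n2 hO]|n3]] := deg d.
  have vE : vertex_of d = [set d; node G d].
    apply/setP => z; rewrite porbit_in !inE; apply/eqP/orP.
      case/porbit_iterP => i _ ->; elim: i => [|i /=]; first by left.
      by case=> /eqP->; [right|left; rewrite n2].
    by case=> /eqP->; rewrite ?porbit_step.
  rewrite vE cards2 [d == _]eq_sym nd; suff -> : boundary_vertex [set d; node G d] by [].
  rewrite /boundary_vertex.
  apply/set0Pn; case/orP: hO => h; [exists d|exists (node G d)];
    by rewrite !inE h eqxx ?orbT.
have nnd : node G (node G d) != d.
  by apply: contra_neq nd => E; rewrite -[in RHS]n3 E.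
have vE : vertex_of d = [set d; node G d; node G (node G d)].
  apply/setP => z; rewrite porbit_in !inE; apply/eqP/orP.
    case/porbit_iterP => i _ ->; elim: i => [|i /=]; first by left; rewrite eqxx.
    case=> [/orP[]|] /eqP->; [by left; rewrite eqxx orbT|by right|].
    by left; rewrite n3 eqxx.
  by case=> [/orP[]|] /eqP->; rewrite ?porbit_step.
have -> : #|vertex_of d| = 3.
  by rewrite vE setUC cardsU1 !inE negb_or nnd (inj_eq perm_inj) nd cards2 eq_sym nd.
by rewrite orbT if_same.
Qed.

Lemma tree_triangle_free : is_tree (inner_faces G) (@inner_dual G) ->
  dual_triangle_free G.
Proof.
case=> _ _ h A B C AB BC CA; have := h [:: A; B; C].
have inn X Y : inner_dual X Y -> X \in inner_faces G by case/and4P.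
have neq (X Y : {set G}) : inner_dual X Y -> X != Y by case/and4P.
have sub : {subset [:: A; B; C] <= inner_faces G}.
  by move=> X; rewrite !in_cons orbF => /or3P[]/eqP->;
    [exact: inn AB|exact: inn BC|exact: inn CA].
move=> /(_ sub) /=; rewrite /ucycle /= AB BC CA /= !inE negb_or.
by rewrite (neq _ _ AB) (neq _ _ BC) [A == C]eq_sym (neq _ _ CA) => /(_ isT).
Qed.

(** A walk that avoids one end of a bridge cannot cross it, so a third vertex lies on the side of
    the other end. Deleting each end in turn puts the third vertex on both sides. *)
Lemma two_connected_bridgeless : simple_graph G -> two_connected G -> bridgeless G.
Proof.
move=> [sl _] [V2 conn] d; apply/eqP => /bridge_cut[g gn gx].
pose gv := at_vertex g; have gvE z : gv (vertex_of z) = g z by apply: at_vertexE.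
pose u := vertex_of d; pose v := vertex_of (edge G d).
have uV : u \in vertices G by apply: porbit_mem_porbits.
have vV : v \in vertices G by apply: porbit_mem_porbits.
have uv : u != v by rewrite eq_sym sl.
have guv : gv u (+) gv v by rewrite !gvE gx eqxx.
have [w] : exists w, w \in vertices G :\: [set u; v].
  apply/set0Pn; rewrite -card_gt0 cardsD (setIidPr _) ?cards2 ?uv ?subn_gt0 //.
  by apply/subsetP => x; rewrite !inE => /orP[]/eqP->.
rewrite !inE negb_or => /andP[/andP[wu wv] wV].
have key a b : 
      (forall z, (z == d) || (z == edge G d) ->
         vertex_of z = a \/ vertex_of (edge G z) = a) ->
    b != a -> b \in vertices G -> w != a -> gv w = gv b.
  move=> ha ba bV wa.
  have aV : a \in vertices G.
    by have [|<-|<-] := ha d; rewrite ?eqxx ?porbit_mem_porbits.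
  have /connectP[p pth ->] : connect [rel s t | [&& s != a, t != a & vertex_adj s t]] w b.
    by apply: (conn a) => //; rewrite !inE ?ba ?wa.
  elim: p (w) pth => //= t p IH s /andP[/and3P[sa ta /existsP[z /andP[/eqP zs /eqP zt]]]].
  have nz : (z == d) || (z == edge G d) = false.
    by apply/negbTE/negP => /ha[E|E]; [rewrite -zs E eqxx in sa|rewrite -zt E eqxx in ta].
  move=> /IH <-; rewrite -zs -zt !gvE.
  by have := gx z; rewrite nz; case: (g z); case: (g _).
have E1 : gv w = gv v.
  apply: (key u) => //.
    by move=> z /orP[]/eqP->; [left|right; rewrite edgeK].
  by rewrite eq_sym.
have E2 : gv w = gv u.
  apply: (key v) => //.
  by move=> z /orP[]/eqP->; [right|left].
by rewrite -E1 -E2 addbb in guv.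
Qed.

Lemma vertex_adj_dart z : vertex_adj (vertex_of z) (vertex_of (edge G z)).
Proof. by apply/existsP; exists z; rewrite !eqxx. Qed.

Lemma degree23_set d z : degree23 G -> vertex_of z = vertex_of d ->
  [\/ z = d, z = node G d | z = node G (node G d)].
Proof.
move=> deg /(degree23_cases deg)[->|->|E]; [by constructor|by constructor|].
have [_ [[n2 _]|n3]] := deg z.
  by constructor 2; rewrite E n2.
by constructor 3; rewrite E n3.
Qed.

(* A cut vertex of degree at most 3 is incident with a bridge. *)
Lemma bridgeless_two_connected :
  simple_graph G -> degree23 G -> bridgeless G -> two_connected G.
Proof.
move=> [sl sm] deg bl; split.
  have /porbitsP[d _] := outer_face G.
  have [nd _] := deg d.
  pose A := [set vertex_of d; vertex_of (edge G d); vertex_of (edge G (node G d))].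
  have <- : #|A| = 3.
    have E1 : vertex_of d != vertex_of (edge G d) by rewrite eq_sym sl.
    have E2 : vertex_of (edge G (node G d)) != vertex_of d.
      by rewrite -(vertex_of_node d) sl.
    have E3 : vertex_of (edge G (node G d)) != vertex_of (edge G d).
      by apply: contra_neq nd => E; apply: sm; rewrite ?vertex_of_node.
    by rewrite /A setUC cardsU1 !inE negb_or E2 E3 cards2 E1.
  apply: subset_leq_card; apply/subsetP => v.
  by rewrite !inE => /orP[/orP[]|] /eqP->; apply: porbit_mem_porbits.
move=> v /porbitsP[d0 vE] x y; rewrite !inE => /andP[xv /porbitsP[dx xE]].
move=> /andP[yv /porbitsP[dy yE]].
set r := [rel _ _ | _].
have rsym : symmetric r.
  move=> s t /=; rewrite andbCA; congr [&& _, _ & _].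
  by apply/existsP/existsP => -[z /andP[za zb]]; exists (edge G z); rewrite edgeK za zb.
case: (boolP (connect r x y)) => // nxy.
(* The component of [x] after deletion of [v], with [v] itself counted outside. *)
pose g z := connect r x (vertex_of z).
have gn z : g (node G z) = g z by rewrite /g vertex_of_node.
have gv z : vertex_of z = v -> g z = false.
  rewrite /g => ->; apply/negbTE/negP => /connectP[p].
  case/lastP: p => [_ /= E|p t]; first by rewrite E eqxx in xv.
  rewrite rcons_path last_rcons => /andP[_ /= /and3P[_ tv _]] E.
  by rewrite E eqxx in tv.
have ge z : vertex_of z != v -> vertex_of (edge G z) != v -> g (edge G z) = g z.
  move=> zv ezv; have rz : r (vertex_of z) (vertex_of (edge G z)).
    by rewrite /= zv ezv vertex_adj_dart.
  apply/idP/idP => h; apply: connect_trans h _; apply: connect1 => //.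
  by rewrite rsym.
have gxy : g dx != g dy.
  rewrite /g /vertex_of -xE -yE connect0 (negPf nxy) //.
(* Of the at most three darts at [v], at most one leads into the component of [x] or at most one
   leads elsewhere. In the first case the component, in the second the component together with [v],
   is bounded by at most one edge, against [bridgeless_cut_const]. *)
pose Zt z := (vertex_of z == v) && g (edge G z).
pose Zf z := (vertex_of z == v) && ~~ g (edge G z).
have [] : (exists z0, forall z, Zt z -> z = z0) \/
                         (exists z0, forall z, Zf z -> z = z0).
  have cs z : vertex_of z == v -> [\/ z = d0, z = node G d0 | z = node G (node G d0)].
    by rewrite vE => /eqP; apply: degree23_set.
  case e1: (g (edge G d0)); case e2: (g (edge G (node G d0)));
    case e3: (g (edge G (node G (node G d0))));
  [right; exists d0|right; exists (node G (node G d0))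
  |right; exists (node G d0)|left; exists d0|right; exists d0
  |left; exists (node G d0)|left; exists (node G (node G d0))|left; exists d0];
  by move=> z /andP[/cs[]->]; rewrite ?e1 ?e2 ?e3.
- case=> z0 Z1; case/eqP: gxy; apply: (bridgeless_cut_const (z0 := z0) bl gn) => z z1 z2.
  have [zv|zv] := eqVneq (vertex_of z) v.
    rewrite (gv _ zv); apply/negbTE; apply: contra z1 => gez.
    by apply/eqP; apply: Z1; rewrite /Zt zv eqxx.
  have [ezv|ezv] := eqVneq (vertex_of (edge G z)) v; last exact: ge.
  rewrite (gv _ ezv); apply/esym/negbTE; apply: contra z2 => gez.
  by rewrite -edge_eq; apply/eqP; apply: Z1; rewrite /Zt ezv eqxx edgeK.
case=> z0 Z1; pose g' z := g z || (vertex_of z == v).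
have gn' z : g' (node G z) = g' z by rewrite /g' gn vertex_of_node.
have : g' dx != g' dy.
  rewrite /g' /vertex_of -xE -yE (negPf xv) (negPf yv) !orbF; exact: gxy.
move/eqP; case; apply: (bridgeless_cut_const (z0 := z0) bl gn') => z z1 z2.
rewrite /g'; have [zv|zv] := eqVneq (vertex_of z) v.
  rewrite orbT; apply: contraNT z1; rewrite negb_or => /andP[gez _].
  by apply/eqP; apply: Z1; rewrite /Zf zv eqxx.
have [ezv|ezv] := eqVneq (vertex_of (edge G z)) v.
  rewrite orbT; apply/esym; apply: contraNT z2; rewrite orbF => gez.
  by rewrite -edge_eq; apply/eqP; apply: Z1; rewrite /Zf ezv eqxx edgeK.
by rewrite !orbF ge.
Qed.

(** The working form of [cers]: bipartiteness is replaced by even face sizes and 2-connectedness by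
    the absence of bridges, both of which are easy to follow through subdivisions. *)
Definition cers_darts :=
  [/\ simple_graph G, even_faces, bridgeless G, degree23 G
    & is_tree (inner_faces G) (@inner_dual G)].

Lemma cersP : cers G <-> cers_darts.
Proof.
split=> [[[si bi tw dg] tr]|[si ev bl dg tr]].
  have bl := two_connected_bridgeless si tw.
  by split=> //; [apply/even_facesP/bipartiteP|apply/degree23P].
split=> //; split=> //; [by apply/bipartiteP/even_facesP| |by apply/degree23P].
exact: bridgeless_two_connected.
Qed.

End Characterization.

(** * Distances between edges of a face *)

Section Distance.
Variables (T : finType) (r : rel T).

Lemma gdist_le x y p : path r x p -> last x p = y -> gdist r x y <= size p.
Proof.
move=> pth lst; rewrite /gdist; set P := fun n => _.
(* A path of length at least [#|T|] is no problem, as [find] is bounded by the length of the list,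
   which is also its default value. *)
have [sp|sp] := leqP #|T| (size p).
  by apply: leq_trans sp; rewrite -[X in _ <= X](size_iota 0) find_size.
rewrite leqNgt; apply/negP => /(before_find 0); rewrite nth_iota // add0n.
move/negbT/negP; apply; rewrite /P; apply/existsP; exists (in_tuple p).
by rewrite pth lst eqxx.
Qed.

Lemma gdist_path x y : connect r x y ->
  exists p, [/\ path r x p, last x p = y & size p = gdist r x y].
Proof.
case/connectP=> p0 /shortenP[p pth up _] ->.
have sp : size p < #|T|.
  by have := card_uniqP up => /= <-; apply: max_card.
set y' := last x p; rewrite /gdist; set P := (P in find P _).
have hasP : has P (iota 0 #|T|).
  apply/hasP; exists (size p); first by rewrite mem_iota.
  by rewrite /P; apply/existsP; exists (in_tuple p); rewrite pth eqxx.
have := nth_find 0 hasP; rewrite  nth_iota;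
  last by rewrite -[X in _ < X](size_iota 0) -has_find.
rewrite add0n => /existsP[q /andP[pq /eqP lq]].
by exists q; rewrite size_tuple.
Qed.
End Distance.

Section EdgeDistance.
Variable G : plane_graph.
Implicit Types x y z d : G.

Lemma endpointsE d : endpoints (edge_of d) = [set vertex_of d; vertex_of (edge G d)].
Proof. by rewrite /endpoints edge_ofE imsetU1 imset_set1. Qed.

Lemma endpoints_adj (e u v : {set G}) : e \in edges G ->
  u \in endpoints e -> v \in endpoints e -> u != v -> vertex_adj u v.
Proof.
case/porbitsP=> d ->; rewrite endpointsE !inE => /orP[]/eqP-> /orP[]/eqP->;
  rewrite ?eqxx // => _; apply/existsP; [exists d|exists (edge G d)];
  by rewrite ?edgeK !eqxx.
Qed.

(** Consecutive edges share a vertex, and two successive shared vertices are equal or are the ends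
    of the edge between them. This saves one step, whence the strict inequality of sizes. *)
Lemma line_path_walk e p : path (@line_adj G) e p -> p != [::] ->
  exists u q, [/\ u \in endpoints e, path (@vertex_adj G) u q,
                  last u q \in endpoints (last e p) & size q < size p].
Proof.
elim: p e => // e1 p IH e /= /andP[/and4P[_ e1E _ /set0Pn[u]]].
rewrite inE => /andP[ue ue1] pth _; have [p0|p0] := eqVneq p [::].
  by exists u, [::]; rewrite p0.
have [v [q [ve1 pq lq sq]]] := IH _ pth p0.
have [uv|uv] := eqVneq u v.
  by exists u, q; rewrite uv in ue *; split=> //; apply: ltnW.
exists u, (v :: q); split=> //=.
by rewrite pq (endpoints_adj e1E).
Qed.

Lemma walk_line_path u q e f : path (@vertex_adj G) u q ->
  e \in edges G -> f \in edges G -> u \in endpoints e ->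
  last u q \in endpoints f ->
  exists p, [/\ path (@line_adj G) e p, last e p = f & size p <= (size q).+1].
Proof.
have step e1 e2 v : e1 \in edges G -> e2 \in edges G -> v \in endpoints e1 ->
    v \in endpoints e2 -> e1 != e2 -> line_adj e1 e2.
  move=> E1 E2 v1 v2 ne; apply/and4P; split=> //.
  by apply/set0Pn; exists v; rewrite inE v1.
move=> + + fE; elim: q u e => [|w q IH] u e /=.
  move=> _ eE ue uf; have [<-|ef] := eqVneq e f; first by exists [::].
  by exists [:: f]; split=> //=; rewrite (step e f u).
move=> /andP[/existsP[d /andP[/eqP du /eqP dw]] pq] eE ue lf.
have dE : edge_of d \in edges G by apply: porbit_mem_porbits.
have [|p [pp lp sp]] := IH w (edge_of d) pq dE _ lf.
  by rewrite endpointsE !inE dw eqxx orbT.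
have [ed|ed] := eqVneq e (edge_of d).
  by exists p; rewrite ed; split=> //; apply: leqW.
exists (edge_of d :: p); split=> //=.
by rewrite pp (step _ _ u) // endpointsE !inE du eqxx.
Qed.

Lemma connect_face_walk d i :
  connect (@vertex_adj G) (vertex_of d) (vertex_of (iter i (face G) d)).
Proof.
elim: i => [|i IH]; first exact: connect0.
apply: connect_trans IH (connect1 _).
by rewrite iterS vertex_of_face vertex_adj_dart.
Qed.

(** Distance in the line graph is one more than the length of a shortest vertex walk between ends of
    the two edges. The minimality clause later keeps this walk away from the other ends. *)
Lemma edge_dist_walk x y : face_of y = face_of x -> edge_of x != edge_of y ->
  exists u q,
    [/\ u \in endpoints (edge_of x), path (@vertex_adj G) u q,
        last u q \in endpoints (edge_of y),
        edge_dist (edge_of x) (edge_of y) = (size q).+1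
      & forall u' q', u' \in endpoints (edge_of x) ->
          path (@vertex_adj G) u' q' -> last u' q' \in endpoints (edge_of y) ->
          size q <= size q'].
Proof.
move=> fxy exy; have [i _ yE] := porbit_iterP fxy.
have xE : edge_of x \in edges G by apply: porbit_mem_porbits.
have yE' : edge_of y \in edges G by apply: porbit_mem_porbits.
have low u' q' : u' \in endpoints (edge_of x) ->
    path (@vertex_adj G) u' q' -> last u' q' \in endpoints (edge_of y) ->
    edge_dist (edge_of x) (edge_of y) <= (size q').+1.
  move=> ux pq ly; have [p [pp lp sp]] := walk_line_path pq xE yE' ux ly.
  exact: leq_trans (gdist_le pp lp) sp.
have con : connect (@line_adj G) (edge_of x) (edge_of y).
  have /connectP[q pq lq] := connect_face_walk x i.
  have [||p [pp lp _]] := walk_line_path pq xE yE'.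
  - by rewrite endpointsE !inE eqxx.
  - by rewrite -lq -yE endpointsE !inE eqxx.
  by apply/connectP; exists p.
have [p [pp lp sp]] := gdist_path con.
have p0 : p != [::] by apply: contra_neq exy => p0; rewrite -lp p0.
have [u [q [ux pq ly sq]]] := line_path_walk pp p0; rewrite lp in ly.
have D : edge_dist (edge_of x) (edge_of y) = (size q).+1.
  by apply/eqP; rewrite eqn_leq (low u q) //= /edge_dist -sp.
exists u, q; split=> // u' q' u'x pq' ly'.
by have := low _ _ u'x pq' ly'; rewrite D ltnS.
Qed.

Lemma cut_walk (g : G -> bool) (A B : {set G}) s q :
  (forall z, g (node G z) = g z) ->
  (forall z, g z != g (edge G z) ->
     (A \in endpoints (edge_of z)) || (B \in endpoints (edge_of z))) ->
  path (@vertex_adj G) s q -> A \notin s :: q -> B \notin s :: q ->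
  at_vertex g (last s q) = at_vertex g s.
Proof.
move=> gn gx; elim: q s => // t q IH s.
move=> /andP[/existsP[z /andP[/eqP <- /eqP <-]] pq].
rewrite in_cons negb_or => /andP[As At]; rewrite in_cons negb_or => /andP[Bs Bt].
rewrite [last _ _]/= (IH _ pq At Bt) !at_vertexE //; apply/eqP; rewrite eq_sym.
apply: contraT => /gx; rewrite endpointsE !inE (negPf As) (negPf Bs) /=.
by move: At Bt; rewrite !in_cons !negb_or => /andP[/negPf-> _] /andP[/negPf-> _].
Qed.

Lemma coloring_walk (c : G -> bool) u q : dart_coloring c ->
  path (@vertex_adj G) u q ->
  at_vertex c (last u q) = odd (size q) (+) at_vertex c u.
Proof.
move=> [cn ce]; elim: q u => //= t q IH u.
move=> /andP[/existsP[z /andP[/eqP <- /eqP <-]] pq].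
by rewrite IH // !at_vertexE // ce addNb addbN.
Qed.

Section Cers.
Hypothesis bl : bridgeless G.
Hypothesis deg : degree23 G.
Hypothesis tri : dual_triangle_free G.

(** A closed curve through an inner face and the outer face crosses only the boundary edges of [b]
    and [b']. These form a cut without shared edges, which separates the two arcs that they leave of
    the inner face. *)
Lemma chord_cut b b' : b != b' -> face_of b' = face_of b -> b \notin outer G ->
  edge G b \in outer G -> edge G b' \in outer G ->
  exists g : G -> bool,
    [/\ forall z, g (node G z) = g z,
        forall z, g z != g (edge G z) -> edge_of z \in [set edge_of b; edge_of b'],
        forall z, shared z -> g (edge G z) = g z,
        g (face G b) = g b'
      & g (face G b) != g b /\ g (face G b') != g b'].
Proof.
move=> bb fb bO ebO ebO'.
have feb : face_of (edge G b') = face_of (edge G b).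
  by apply/eqP; move: ebO ebO'; rewrite !outerE => /eqP-> /eqP->.
have bO' : b' \notin outer G by rewrite (outer_of fb).
have beb' : b != edge G b' by apply: contraNneq bO => ->.
have [g gn gx] := double_edge_cut fb feb.
have gs z : g z != g (edge G z) -> edge_of z \in [set edge_of b; edge_of b'].
  move=> gz; have := gx z; rewrite -negb_eqb gz => /esym.
  rewrite !inE; case: (eqVneq z b) => [->|_]; first by rewrite eqxx.
  case: (eqVneq z (edge G b)) => [->|_]; first by rewrite edge_of_edge eqxx.
  case: (eqVneq z b') => [->|_]; first by rewrite eqxx orbT.
  by case: (eqVneq z (edge G b')) => [->|_ //=]; rewrite edge_of_edge eqxx !orbT.
exists g; split=> //.
- move=> z shz; apply/eqP; rewrite eq_sym; apply: contraTT shz => /gs.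
  rewrite !inE => /orP[] /eqP /esym /edge_of_inj[] ->;
    by rewrite ?shared_edge /shared ?ebO ?ebO' andbF.
- have [m mN bE] := porbit_iterP fb; have m0 : 0 < m.
    by rewrite lt0n; apply: contra_neq bb => m0; rewrite bE m0.
  rewrite [in RHS]bE; apply/esym; apply: cut_arc => // i /andP[i0 im].
  apply/eqP; rewrite eq_sym; apply: contraT => /gs.
  have iN := ltn_trans im mN.
  have inF : face_of (iter i (face G) b) = face_of b by rewrite face_of_iter.
  rewrite !inE => /orP[] /eqP /(face_edge_of_inj bl) E.
    have /(iter_porbit_inj iN) : iter i (face G) b = iter 0 (face G) b by exact: E.
    by rewrite (leq_trans _ iN) // => /(_ isT) i00; rewrite i00 in i0.
  have /(iter_porbit_inj iN) : iter i (face G) b = iter m (face G) b.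
    by rewrite -bE; apply: E; rewrite fb.
  by move=> /(_ mN) E'; rewrite E' ltnn in im.
- rewrite !faceE !gn.
  have b1 := gx b; have b2 := gx b'.
  move: b1 b2; rewrite !eqxx /= (negPf bb) (negPf beb') [b' == b]eq_sym (negPf bb) /=.
  rewrite [b' == _]eq_sym edge_eq (negPf beb') /=.
  by do 4![case: (g _)].
Qed.

(* Shortest walks between the ends of x and y go around the face on either    *)
(* side; a walk of the wrong parity would cross a chord of the face.          *)
Lemma odd_edge_dist (c : G -> bool) x y : dart_coloring c ->
  shared x -> shared y -> face_of y = face_of x -> x != y ->
  odd (edge_dist (edge_of x) (edge_of y)) = c x (+) c y.
Proof.
move=> hc shx shy fxy xy; have [xO exO] := andP shx; have [yO eyO] := andP shy.
have exy : edge_of x != edge_of y.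
  by apply: contra_neq xy => E; apply: (face_edge_of_inj bl).
have [u [q [ux pq ly -> mn]]] := edge_dist_walk fxy exy.
have [cn ce] := hc; have := coloring_walk hc pq.
(* A walk through the other end of [x] could be shortened by starting there; [avoid_v] is the same
   at the end of the walk. *)
have avoid_u u' : u' \in endpoints (edge_of x) -> u' != u -> u' \notin u :: q.
  move=> u'x u'u; rewrite in_cons (negPf u'u) /=; apply/negP => /splitPr qE.
  case: qE pq ly mn => q1 q2; rewrite cat_path last_cat /= => /and3P[_ _ pq2] ly mn.
  by have := mn _ _ u'x pq2 ly; rewrite size_cat /= addnS ltnNge leq_addl.
have avoid_v v' : v' \in endpoints (edge_of y) -> v' != last u q -> v' \notin u :: q.
  move=> v'y v'l; apply/negP => /splitPl qE.
  case: qE pq ly mn v'l => q1 q2 lq1; rewrite cat_path => /andP[pq1 _] ly mn.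
  have := mn _ _ ux pq1; rewrite lq1 => /(_ v'y).
  rewrite size_cat -[X in _ <= X]addn0 leq_add2l leqn0.
  by case: q2 {ly mn} => // _; rewrite cats0 lq1 eqxx.
have neq d : vertex_of (edge G d) != vertex_of d.
  by apply/eqP => E; have := ce d; rewrite -!(at_vertexE cn) E; case: at_vertex.
move: ux ly pq mn avoid_u avoid_v; rewrite !endpointsE !inE.
case/orP=> /eqP ->; case/orP => /eqP vE pq mn au av; rewrite vE !at_vertexE // ?ce.
(* A walk from the origin of [x] to the origin of [y] has the wrong parity. It avoids the origins of
   [face G x] and [face G y], so it cannot cross the cut formed by these two boundary edges,
   although the cut separates its ends. *)
- have Au := au _ (set22 _ _) (neq x).
  have := av _ (set22 _ _); rewrite vE neq => /(_ isT) Av.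
  have [|||||g [gn gx gs gb [gb1 gb2]]] := @chord_cut (face G x) (face G y).
  + by rewrite (inj_eq perm_inj).
  + by rewrite !face_of_face.
  + by rewrite outer_face_dart.
  + exact: outer_after_shared.
  + exact: outer_after_shared.
  have := cut_walk gn _ pq Au Av; rewrite vE !at_vertexE // => E.
  exfalso; move: gb1; rewrite gb !faceE !gn !gs // E ?eqxx // => z.
  move=> /gx; rewrite !inE => /orP[] /eqP->;
    by rewrite endpointsE !inE !vertex_of_face eqxx ?orbT.
- by rewrite /=; case: (odd (size q)); case: (c x); case: (c y).
- by rewrite /=; case: (odd (size q)); case: (c x); case: (c y).
(* The mirror image: the walk joins the far ends of [x] and [y], and the cut consists of the edges
   that precede [x] and [y] on the face. *)
- have Au := au _ (set21 _ _); rewrite eq_sym neq in Au; move/(_ isT): Au => Au.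
  have := av _ (set21 _ _); rewrite vE eq_sym neq => /(_ isT) Av.
  pose b := (face G)^-1%g x; pose b' := (face G)^-1%g y.
  have bx : face G b = x by rewrite permKV.
  have by' : face G b' = y by rewrite permKV.
  have [|||||g [gn gx gs gb [gb1 gb2]]] := @chord_cut b b'.
  + by rewrite (inj_eq perm_inj).
  + by rewrite -face_of_face by' -(face_of_face b) bx.
  + by rewrite -outer_face_dart bx.
  + by apply: outer_before_shared; rewrite ?bx.
  + by apply: outer_before_shared; rewrite ?by'.
  have := cut_walk gn _ pq Au Av; rewrite vE !at_vertexE // !gs // => E.
  exfalso; move: gb2; rewrite -gb bx by' E ?eqxx // => z.
  move=> /gx; rewrite !inE => /orP[] /eqP->;
    by rewrite endpointsE !inE -!vertex_of_face ?bx ?by' eqxx ?orbT.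
Qed.

Lemma even_edge_dist (c : G -> bool) : dart_coloring c ->
  forall x y, shared x -> shared y -> face_of y = face_of x -> x != y ->
  ~~ odd (edge_dist (edge_of x) (edge_of y)) = (c x == c y).
Proof.
by move=> hc x y sx sy fxy xy; rewrite (odd_edge_dist hc) // negb_add.
Qed.

End Cers.
End EdgeDistance.

(** * Normality in terms of colours *)

Section Normality.
Variable G : plane_graph.
Implicit Types x y z d : G.
Hypothesis hG : cers_darts G.

Let bl : bridgeless G. Proof. by case: hG. Qed.
Let deg : degree23 G. Proof. by case: hG. Qed.
Let tri : dual_triangle_free G.
Proof. by case: hG => _ _ _ _ /tree_triangle_free. Qed.

Definition shared_of x : {set G} := [set y in face_of x | shared y].

Lemma in_shared_of x y :
  reflect (face_of y = face_of x /\ shared y) (y \in shared_of x).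
Proof.
rewrite inE porbit_in -!/(face_of _).
by apply: (iffP andP) => -[/eqP].
Qed.

(** The dart [y3] only witnesses a third shared edge; by symmetry all three darts then have the same
    colour. *)
Definition normal_darts (c : G -> bool) := forall x, x \notin outer G ->
  #|shared_of x| <= 3 /\
  {in shared_of x & &, forall y1 y2 y3,
     y1 != y2 -> y1 != y3 -> y2 != y3 -> c y1 = c y2}.

Lemma neighbours_shared x : x \notin outer G ->
  [set F | inner_dual (face_of x) F] =
  [set face_of (edge G y) | y in shared_of x].
Proof.
move=> xO; apply/setP => F; rewrite inE; apply/inner_dualP/imsetP.
  by case=> d [shd fx fd _]; exists d => //; apply/in_shared_of.
case=> y /in_shared_of[fy shy] ->; exists y; split=> //.
by rewrite -fy eq_sym bl.
Qed.

Lemma shared_of_inj x : {in shared_of x &, injective (fun y => face_of (edge G y))}.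
Proof.
move=> y1 y2 /in_shared_of[f1 sh1] /in_shared_of[f2 sh2] E.
by apply: shared_unique => //; rewrite f1 f2.
Qed.

(** By [shared_unique] the neighbours of a face correspond to its shared darts, and by
    [even_edge_dist] a triple is regular exactly when its two shared darts have equal colours. *)
Lemma normal_cersP (c : G -> bool) : dart_coloring c ->
  normal_cers G <-> normal_darts c.
Proof.
move=> hc; split=> [[h3 hreg] x xO|nd].
  split.
    have := h3 (face_of x); rewrite inner_facesE => /(_ xO).
    by rewrite neighbours_shared // card_in_imset //; apply: shared_of_inj.
  move=> y1 y2 y3 Y1 Y2 Y3 n12 n13 n23.
  have dl y : y \in shared_of x -> inner_dual (face_of x) (face_of (edge G y)).
    by move=> Y; have := imset_f (fun y => face_of (edge G y)) Y;
      rewrite -neighbours_shared // inE.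
  have ne y y' : y \in shared_of x -> y' \in shared_of x -> y != y' ->
      face_of (edge G y) != face_of (edge G y').
    by move=> Y Y'; apply: contra_neq; apply: shared_of_inj Y Y'.
  have [r12 _ _] := hreg _ _ _ _ (dl _ Y1) (dl _ Y2) (dl _ Y3)
     (ne _ _ Y1 Y2 n12) (ne _ _ Y1 Y3 n13) (ne _ _ Y2 Y3 n23).
  have [[f1 s1] [f2 s2]] := (in_shared_of _ _ Y1, in_shared_of _ _ Y2).
  have mem y : face_of y = face_of x ->
      edge_of y \in face_edges (face_of x) /\ edge_of y \in face_edges (face_of (edge G y)).
    move=> fy; split; apply/face_edgesP; rewrite ?porbit_mem_porbits //; first by exists y.
    by exists (edge G y); rewrite ?edge_of_edge.
  have := r12 (edge_of y1) (edge_of y2).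
  have [m1 m1'] := mem _ f1; have [m2 m2'] := mem _ f2.
  rewrite !inE m1 m1' m2 m2' => /(_ isT isT).
  rewrite (even_edge_dist bl deg tri hc) //; first by move/eqP.
  by rewrite f2.
have key (F F1 F2 F3 : {set G}) : inner_dual F F1 -> inner_dual F F2 -> inner_dual F F3 ->
    F1 != F2 -> F1 != F3 -> F2 != F3 -> regular_triple F1 F F2.
  move=> d1 d2 d3 n12 n13 n23 e f.
  have [x xO FE] : exists2 x, x \notin outer G & F = face_of x.
    by case/and4P: d1 => /inner_facesP[x xO E]; exists x.
  have [_ hx] := nd x xO.
  have rep F' : inner_dual F F' -> exists2 y, y \in shared_of x & F' = face_of (edge G y).
    rewrite FE => h; have: F' \in [set F' | inner_dual (face_of x) F'] by rewrite inE.
    by rewrite neighbours_shared // => /imsetP.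
  have [[y1 Y1 E1] [y2 Y2 E2]] := (rep _ d1, rep _ d2); have [y3 Y3 E3] := rep _ d3.
  have [[f1 s1] [f2 s2]] := (in_shared_of _ _ Y1, in_shared_of _ _ Y2).
  rewrite E1 E2 FE setIC -f1 => /(face_edges_shared bl deg tri s1) ->.
  rewrite f1 -f2 => /(face_edges_shared bl deg tri s2) ->.
  have ne y y' : face_of (edge G y) != face_of (edge G y') -> y != y'.
    by apply: contra_neq => ->.
  rewrite (even_edge_dist bl deg tri hc) //.
  - by apply/eqP; apply: (hx y1 y2 y3) => //; apply: ne; rewrite -?E1 -?E2 -?E3.
  - by rewrite f2.
  - by apply: ne; rewrite -E1 -E2.
split=> [F|F F1 F2 F3 d1 d2 d3 n12 n13 n23].
  case/inner_facesP => x xO ->; rewrite neighbours_shared // card_in_imset.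
    by have [] := nd x xO.
  exact: shared_of_inj.
split; [exact: (key F F1 F2 F3)|apply: (key F F1 F3 F2)|apply: (key F F2 F3 F1)] => //.
- by rewrite eq_sym.
- by rewrite eq_sym.
- by rewrite eq_sym.
Qed.

(** The shared darts of a hexagon and their successors form disjoint sets of equal size, so at most
    three darts are shared. If there are three, they alternate with the others and hence have one
    colour. *)
Lemma benzenoid_normal (c : G -> bool) : dart_coloring c ->
  (forall F, F \in inner_faces G -> #|F| = 6) -> normal_darts c.
Proof.
move=> hc h6 x xO.
have N6 : #|face_of x| = 6 by apply: h6; rewrite inner_facesE.
pose S := shared_of x; pose S' := face G @: S.
have SF : S \subset face_of x by apply/subsetP => y; rewrite inE => /andP[].
have S'F : S' \subset face_of x.
  apply/subsetP => _ /imsetP[y /in_shared_of[fy _] ->].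
  by rewrite porbit_in -!/(face_of _) face_of_face fy.
have dis : [disjoint S & S'].
  rewrite -setI_eq0; apply/eqP/setP => y; rewrite !inE; apply/negP.
  case/andP=> /andP[_ shy] /imsetP[z /in_shared_of[_ shz] yE].
  by have := shared_face bl deg tri shz; rewrite -yE shy.
have cS' : #|S'| = #|S| by rewrite card_imset //; apply: perm_inj.
have cU : #|S :|: S'| = #|S| + #|S|.
  by have := leq_card_setU S S'; rewrite cS' => /leqifP; rewrite dis => /eqP.
have sub : S :|: S' \subset face_of x by rewrite subUset SF.
have S3 : #|S| <= 3.
  by have := subset_leq_card sub; rewrite cU N6 addnn (leq_double _ 3).
split=> // y1 y2 y3 Y1 Y2 Y3 n12 n13 n23.
have {}S3 : #|S| = 3.
  apply/eqP; rewrite eqn_leq S3 -(_ : #|[set y1; y2; y3]| = 3).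
    by apply: subset_leq_card; apply/subsetP => z; rewrite inE => /orP[/set2P[]|/set1P] ->.
  by rewrite setUC cardsU1 !inE negb_or ![y3 == _]eq_sym n13 n23 cards2 n12.
have UF : S :|: S' = face_of x.
  by apply/eqP; rewrite eqEcard sub cU N6 S3.
have step y : y \in S -> face G (face G y) \in S.
  move=> yS; have : face G (face G y) \in S :|: S'.
    by rewrite UF porbit_in -!/(face_of _) !face_of_face; case/in_shared_of: yS => ->.
  rewrite inE => /orP[//|/imsetP[z zS /perm_inj E]].
  have := disjointFr dis zS; rewrite -E.
  by rewrite (imset_f (face G) yS).
have all_i i : iter i (fun y => face G (face G y)) y1 \in S.
  by elim: i => //= i; apply: step.
have it i : iter i (fun y => face G (face G y)) y1 = iter i.*2 (face G) y1.
  by elim: i => //= i ->.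
have [[f1 s1] [f2 s2]] := (in_shared_of _ _ Y1, in_shared_of _ _ Y2).
have [k _ y2E] : exists2 k, k < #|face_of y1| & y2 = iter k (face G) y1.
  by apply: porbit_iterP; rewrite -/(face_of _) f2.
rewrite y2E (coloring_iter_face hc); case kO: (odd k) => //.
have: y2 \in S' .
  rewrite y2E -(odd_double_half k) kO add1n iterS -it; apply: imset_f; exact: all_i.
by have := disjointFr dis Y2 => ->.
Qed.

(* In other words, a face boundary minus the segment is connected. *)
Lemma segment_arc (P : {set {set G}}) x y : boundary_segment P ->
  shared x -> shared y -> face_of y = face_of x ->
  (exists2 k, y = iter k (face G) x &
     forall i, i < k -> edge_of (iter i (face G) x) \notin P) \/
  (exists2 k, x = iter k (face G) y &
     forall i, i < k -> edge_of (iter i (face G) y) \notin P).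
Proof.
case=> F [e0 [FI e0B PE]] shx shy fxy.
set B := _ :&: _ in e0B PE; set r := [rel _ _ | _] in PE.
have FF : F \in faces G by move: FI; rewrite inE => /andP[].
have OF : outer G \in faces G := outer_face G.
have BP e : e \in B -> exists d, [/\ face_of d = F, e = edge_of d & ~~ shared d].
  rewrite inE => /andP[/(face_edgesP _ FF)[d fd ->]] /(face_edgesP _ OF)[d' fd'].
  move=> /edge_of_inj E; exists d; split=> //.
  have: d' \in outer G by rewrite outerE fd'.
  by case: E => -> h; rewrite /shared h ?andbF.
have PB e : e \in P -> e \in B.
  rewrite PE inE => /connectP[p]; case/lastP: p => [|p t]; first by move=> _ ->.
  by rewrite rcons_path last_rcons => /andP[_ /and3P[_ ? _]] ->.
have [k kN yE] := porbit_iterP fxy; rewrite -/(face_of x) in kN.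
(* If the segment lies on another inner face, its edges separate that face from the outer one, so
   none of them is on the face of [x]. *)
have [fxF|fxF] := eqVneq (face_of x) F; last first.
  left; exists k => // i _; apply/negP => /PB /BP[d [fd dE nsh]].
  have [E|E] := edge_of_inj dE; first by rewrite -fd E face_of_iter eqxx in fxF.
  have dO : d \notin outer G by rewrite outerE fd; move: FI; rewrite !inE => /andP[].
  case/negP: nsh; rewrite /shared dO E edgeK outerE face_of_iter -outerE.
  by case/andP: shx.
pose S := [set edge_of (iter i (face G) x) | i : 'I_k].
have SP i : i < k -> edge_of (iter i (face G) x) \in S.
  by move=> ik; apply/imsetP; exists (Ordinal ik).
(* Adjacent edges of [B] on this face are consecutive, since the face visits each vertex once.
   Leaving the arc within [B] would require passing [x] or [y], which are shared and so carry no
   edge of [B]. *)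
have clS e f : r e f -> e \in S -> f \in S.
  case/and3P=> eB fB /and4P[_ _ ef /set0Pn[v vef]] /imsetP[i _ eE].
  have [z' [fz' fE nshz']] := BP _ fB.
  pose z := iter i (face G) x; have fz : face_of z = F by rewrite face_of_iter.
  have nshz : ~~ shared z.
    have [z1 [f1 E1 n1]] := BP _ eB.
    suff -> : z = z1 by []. apply: (face_edge_of_inj bl); first by rewrite fz f1.
    by rewrite -E1.
  have inj a b : face_of a = F -> face_of b = F -> vertex_of a = vertex_of b -> a = b.
    by move=> fa fb; apply: (face_vertex_inj bl deg); rewrite fa fb.
  have neq : z <> z' by move=> E; rewrite eE fE -/z E eqxx in ef.
  have [E|E] : z' = face G z \/ z = face G z'.
    move: vef; rewrite eE fE -/z in_setI !endpointsE -!vertex_of_face.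
    rewrite !in_set2 => /andP[/orP[]/eqP-> /orP[]/eqP] E.
    - by case: neq; apply: inj.
    - by right; apply: inj => //; rewrite face_of_face.
    - by left; apply/esym; apply: inj => //; rewrite face_of_face.
    - by case: neq; apply: (@perm_inj _ (face G)); apply: inj => //; rewrite face_of_face.
  - rewrite fE E; apply: (SP i.+1); rewrite ltn_neqAle ltn_ord andbT.
    by apply: contraNneq nshz' => ik; rewrite E /z -iterS ik -yE.
  have i0 : i != 0 :> nat.
    by apply: contraNneq nshz => i0; rewrite /z i0.
  rewrite fE; have -> : z' = iter i.-1 (face G) x.
    by apply: (@perm_inj _ (face G)); rewrite -E -iterS prednK // lt0n.
  by apply: SP; rewrite (leq_ltn_trans (leq_pred _)).
have rsym : symmetric r.
  move=> e f /=; rewrite /line_adj /= setIC [e == f]eq_sym; apply/idP/idP;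
  by case/and3P=> -> -> /and4P[-> -> -> ->].
have cl : closed r (mem S).
  by apply: intro_closed => [|e f]; [apply: sym_connect_sym|apply: clS].
have PS e : e \in P -> (e \in S) = (e0 \in S).
  by rewrite PE inE => /(closed_connect cl) <-.
(* The segment is thus inside the arc from [x] to [y] or disjoint from it. If inside, the
   complementary arc from [y] to [x] avoids it. *)
case e0S : (e0 \in S); last first.
  left; exists k => // i ik; apply/negP => /PS.
  by rewrite SP // e0S.
right; exists (#|face_of x| - k).
  by rewrite yE -iterD subnK ?iter_porbit // ltnW.
move=> i ik; apply/negP => /PS; rewrite e0S => /imsetP[j _].
rewrite yE -iterD => /(face_edge_of_inj bl); rewrite !face_of_iter => /(_ (erefl _)).
have jk := ltn_ord j; rewrite ltn_subRL addnC in ik.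
move/(iter_porbit_inj ik) => /(_ (ltn_trans jk kN)) E.
by rewrite -E -[X in _ < X]add0n ltn_add2r in jk.
Qed.

End Normality.

(** * Subdivisions *)

Lemma connect_homo (T U : finType) (r : rel T) (r' : rel U) (f : T -> U) :
  (forall x y, r x y -> connect r' (f x) (f y)) ->
  forall x y, connect r x y -> connect r' (f x) (f y).
Proof.
move=> h x y /connectP[p]; elim: p x => [|z p IH] x /=; first by move=> _ ->.
by move=> /andP[/h xz pth] /(IH _ pth); apply: connect_trans.
Qed.

Lemma card_porbits_image (T U : finType) (s : {perm T}) (s' : {perm U}) (phi : T -> U) :
  (forall x y, porbit s' (phi x) = porbit s' (phi y) <-> porbit s x = porbit s y) ->
  #|[set porbit s' (phi x) | x : T]| = #|porbits s|.
Proof.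
move=> h; have pre x : phi @^-1: porbit s' (phi x) = porbit s x.
  by apply/setP => y; rewrite inE !porbit_in; apply/eqP/eqP => /h.
have -> : porbits s = (fun O : {set U} => phi @^-1: O) @: [set porbit s' (phi x) | x : T].
  apply/setP => O; apply/porbitsP/imsetP => [[x ->]|[_ /imsetP[x _ ->] ->]].
    by exists (porbit s' (phi x)); rewrite ?pre ?imset_f.
  by exists x; rewrite pre.
rewrite card_in_imset // => _ _ /imsetP[x _ ->] /imsetP[y _ ->].
by rewrite !pre => /h.
Qed.

Lemma card_porbits_involution (T : finType) (e : {perm T}) :
  involutive e -> (forall x, e x != x) -> #|T| = #|porbits e|.*2.
Proof.
move=> eK en; rewrite -[LHS]sum1_card (partition_big (porbit e) [in porbits e]) /=; last first.
  by move=> x _; apply: porbit_mem_porbits.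
rewrite (eq_bigr (fun _ => 2)); first by rewrite sum_nat_const muln2.
move=> O OP; rewrite sum1dep_card.
have -> : [set x | porbit e x == O] = O.
  by apply/setP => x; rewrite inE -(porbits_porbit _ OP).
by case/porbitsP: OP => x ->; rewrite porbit_involutive // cards2 eq_sym en.
Qed.

(* The conditions of [subdivision] on the permutations alone, so that they    *)
(* can be used before the second plane graph has been built.                  *)
Record subdivided (T U : finType) (e n : {perm T}) (e' n' : {perm U})
    (phi : T -> U) (d : T) (a b : U) : Prop := Subdivided {
  sdv_eK : involutive e;
  sdv_en : forall x, e x != x;
  sdv_inj : injective phi;
  sdv_ab : a != b;
  sdv_codom : forall y, (y \in codom phi) = (y != a) && (y != b);
  sdv_ed : e' (phi d) = a;
  sdv_eed : e' (phi (e d)) = b;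
  sdv_e : forall x, x != d -> x != e d -> e' (phi x) = phi (e x);
  sdv_na : n' a = b;
  sdv_nb : n' b = a;
  sdv_n : forall x, n' (phi x) = phi (n x);
  sdv_e'K : involutive e'
}.

Section Subdivided.
Variables (T U : finType) (e n : {perm T}) (e' n' : {perm U}).
Variables (phi : T -> U) (d : T) (a b : U).
Hypothesis h : subdivided e n e' n' phi d a b.
Let f := (e * n)%g.
Let f' := (e' * n')%g.

Lemma sdv_cases y : [\/ exists x, y = phi x, y = a | y = b].
Proof.
have := sdv_codom h y; case: (eqVneq y a) => [->|_]; first by constructor 2.
case: (eqVneq y b) => [->|_] /=; first by constructor 3.
by case/codomP => x ->; constructor 1; exists x.
Qed.

Lemma sdv_phi_a x : phi x != a.
Proof. by have := sdv_codom h (phi x); rewrite codom_f => /esym/andP[]. Qed.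

Lemma sdv_phi_b x : phi x != b.
Proof. by have := sdv_codom h (phi x); rewrite codom_f => /esym/andP[]. Qed.

Lemma sdv_ea : e' a = phi d.
Proof. by rewrite -(sdv_ed h) (sdv_e'K h). Qed.

Lemma sdv_eb : e' b = phi (e d).
Proof. by rewrite -(sdv_eed h) (sdv_e'K h). Qed.

Lemma sdv_e'n y : e' y != y.
Proof.
case: (sdv_cases y) => [[x ->]|->|->]; last 2 first.
- by rewrite sdv_ea sdv_phi_a.
- by rewrite sdv_eb sdv_phi_b.
case: (eqVneq x d) => [->|x1]; first by rewrite (sdv_ed h) eq_sym sdv_phi_a.
case: (eqVneq x (e d)) => [->|x2]; first by rewrite (sdv_eed h) eq_sym sdv_phi_b.
by rewrite (sdv_e h) // (inj_eq (sdv_inj h)) (sdv_en h).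
Qed.

(* The new dart b lies in the face of d, and a in the face of e d. *)
Definition sdv_retract (y : U) : T :=
  if [pick x | phi x == y] is Some x then x else if y == b then d else e d.
Let psi := sdv_retract.

Lemma sdv_retract_phi x : psi (phi x) = x.
Proof.
rewrite /psi /sdv_retract; case: pickP => [z /eqP/(sdv_inj h)//|/(_ x)].
by rewrite eqxx.
Qed.

Lemma sdv_retract_b : psi b = d.
Proof.
rewrite /psi /sdv_retract; case: pickP => [z|]; first by rewrite (negPf (sdv_phi_b z)).
by rewrite eqxx.
Qed.

Lemma sdv_retract_a : psi a = e d.
Proof.
rewrite /psi /sdv_retract; case: pickP => [z|]; first by rewrite (negPf (sdv_phi_a z)).
by rewrite (negPf (sdv_ab h)).
Qed.

Lemma sdv_fd : f' (phi d) = b. Proof. by rewrite permM (sdv_ed h) (sdv_na h). Qed.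
Lemma sdv_fb : f' b = phi (f d). Proof. by rewrite !permM sdv_eb (sdv_n h). Qed.
Lemma sdv_fed : f' (phi (e d)) = a. Proof. by rewrite permM (sdv_eed h) (sdv_nb h). Qed.
Lemma sdv_fa : f' a = phi (f (e d)).
Proof. by rewrite !permM sdv_ea (sdv_n h) (sdv_eK h). Qed.
Lemma sdv_f x : x != d -> x != e d -> f' (phi x) = phi (f x).
Proof. by move=> x1 x2; rewrite !permM (sdv_e h) // (sdv_n h). Qed.

Lemma sdv_porbit_f x : porbit f' (phi (f x)) = porbit f' (phi x).
Proof.
case: (eqVneq x d) => [->|x1].
  by rewrite -sdv_fb porbit_step -sdv_fd porbit_step.
case: (eqVneq x (e d)) => [->|x2].
  by rewrite -sdv_fa porbit_step -sdv_fed porbit_step.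
by rewrite -sdv_f // porbit_step.
Qed.

Lemma sdv_retract_f y : porbit f (psi (f' y)) = porbit f (psi y).
Proof.
case: (sdv_cases y) => [[x ->]|->|->]; last 2 first.
- by rewrite sdv_fa sdv_retract_phi porbit_step sdv_retract_a.
- by rewrite sdv_fb sdv_retract_phi porbit_step sdv_retract_b.
rewrite sdv_retract_phi; case: (eqVneq x d) => [->|x1].
  by rewrite sdv_fd sdv_retract_b.
case: (eqVneq x (e d)) => [->|x2]; first by rewrite sdv_fed sdv_retract_a.
by rewrite sdv_f // sdv_retract_phi porbit_step.
Qed.

Lemma sdv_porbit_face x y :
  porbit f' (phi x) = porbit f' (phi y) <-> porbit f x = porbit f y.
Proof.
split=> E.
  by have := porbit_fun_const sdv_retract_f E; rewrite !sdv_retract_phi.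
exact: (porbit_fun_const sdv_porbit_f E).
Qed.

Lemma sdv_porbit_retract y : porbit f' (phi (psi y)) = porbit f' y.
Proof.
case: (sdv_cases y) => [[x ->]|->|->]; first by rewrite sdv_retract_phi.
  by rewrite sdv_retract_a -sdv_fed porbit_step.
by rewrite sdv_retract_b -sdv_fd porbit_step.
Qed.

Lemma sdv_porbit_edge x : porbit f' (e' (phi x)) = porbit f' (phi (e x)).
Proof.
case: (eqVneq x d) => [->|x1].
  by rewrite (sdv_ed h) -sdv_fed porbit_step.
case: (eqVneq x (e d)) => [->|x2].
  by rewrite (sdv_eed h) (sdv_eK h) -sdv_fd porbit_step.
by rewrite (sdv_e h).
Qed.

Lemma sdv_iter_n i x : iter i n' (phi x) = phi (iter i n x).
Proof. by elim: i => //= i ->; rewrite (sdv_n h). Qed.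

Lemma sdv_porbit_node x y :
  porbit n' (phi x) = porbit n' (phi y) <-> porbit n x = porbit n y.
Proof.
split=> /porbit_iterP[i _ E].
  by move: E; rewrite sdv_iter_n => /(sdv_inj h) ->; rewrite porbit_iter.
by rewrite E -sdv_iter_n porbit_iter.
Qed.

Lemma sdv_porbit_new y : (y \in porbit n' a) = (y == a) || (y == b).
Proof.
rewrite porbit_in; apply/eqP/orP => [/porbit_iterP[i _ ->]|].
  elim: i => [|i /= [] /eqP->]; [by left|by right; rewrite (sdv_na h)|].
  by left; rewrite (sdv_nb h).
by case=> /eqP->; rewrite // -(sdv_na h) porbit_step.
Qed.

Lemma sdv_card_nodes : #|porbits n'| = #|porbits n|.+1.
Proof.
rewrite -(card_porbits_image sdv_porbit_node) (cardsD1 (porbit n' a)) porbit_mem_porbits.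
rewrite add1n; congr (_.+1); apply: eq_card => O; rewrite !inE.
apply/andP/imsetP => [[Oa /porbitsP[y OE]]|[x _ ->]].
  case: (sdv_cases y) => [[x yE]|yE|yE]; first by exists x; rewrite // OE yE.
    by rewrite OE yE eqxx in Oa.
  by rewrite OE yE -(sdv_na h) porbit_step eqxx in Oa.
split; last exact: porbit_mem_porbits.
by rewrite -porbit_in sdv_porbit_new (negPf (sdv_phi_a x)) (negPf (sdv_phi_b x)).
Qed.

Lemma sdv_card_faces : #|porbits f'| = #|porbits f|.
Proof.
rewrite -(card_porbits_image sdv_porbit_face); apply: eq_card => O.
apply/porbitsP/imsetP => [[y ->]|[x _ ->]]; last by exists (phi x).
by exists (psi y); rewrite ?sdv_porbit_retract.
Qed.

Lemma sdv_card : #|U| = #|T|.+2.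
Proof.
rewrite -cardsT (cardsD1 a) (cardsD1 b) !inE eq_sym (sdv_ab h) /= !add1n.
congr _.+2; rewrite -[RHS]cardsT -(card_imset _ (sdv_inj h)).
apply: eq_card => y; rewrite !inE andbT andbC -(sdv_codom h).
by apply/codomP/imsetP => [[x ->]|[x _ ->]]; exists x.
Qed.

Lemma sdv_card_edges : #|porbits e'| = #|porbits e|.+1.
Proof.
have := sdv_card; rewrite (card_porbits_involution (sdv_e'K h) sdv_e'n).
rewrite (card_porbits_involution (sdv_eK h) (sdv_en h)) -doubleS.
exact: double_inj.
Qed.

(** There is one more vertex, one more edge and the same number of faces. As an equality of truth
    values it serves both subdividing and smoothing. *)
Lemma sdv_euler :
  (#|porbits n'| + #|porbits f'| == #|porbits e'| + 2) =
  (#|porbits n| + #|porbits f| == #|porbits e| + 2).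
Proof. by rewrite sdv_card_nodes sdv_card_faces sdv_card_edges !addSn eqSS. Qed.

Let r := [rel x y | (y == e x) || (y == n x)].
Let r' := [rel x y | (y == e' x) || (y == n' x)].

Lemma sdv_connected :
  (forall x y, connect r x y) <-> (forall x y, connect r' x y).
Proof.
have r1 y : connect r' y (e' y) by apply: connect1; rewrite /= eqxx.
have r2 y : connect r' y (n' y) by apply: connect1; rewrite /= eqxx orbT.
split=> conn x y.
  have hom : forall x y, connect r x y -> connect r' (phi x) (phi y).
    apply: connect_homo => {x y}x y /orP[] /eqP->; last by rewrite -(sdv_n h).
    case: (eqVneq x d) => [->|x1].
      apply: connect_trans (r1 _) _; rewrite (sdv_ed h).
      by apply: connect_trans (r2 _) _; rewrite (sdv_na h) -sdv_eb.
    case: (eqVneq x (e d)) => [->|x2]; last by rewrite -(sdv_e h).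
    rewrite (sdv_eK h); apply: connect_trans (r1 _) _; rewrite (sdv_eed h).
    by apply: connect_trans (r2 _) _; rewrite (sdv_nb h) -sdv_ea.
  have [x1 cx] : exists x1, connect r' x (phi x1).
    case: (sdv_cases x) => [[x1 ->]|->|->]; first by exists x1; apply: connect0.
      by exists d; rewrite -sdv_ea.
    by exists (e d); rewrite -sdv_eb.
  have [y1 cy] : exists y1, connect r' (phi y1) y.
    case: (sdv_cases y) => [[y1 ->]|->|->]; first by exists y1; apply: connect0.
      by exists d; rewrite -(sdv_ed h).
    by exists (e d); rewrite -(sdv_eed h).
  exact: connect_trans (connect_trans cx (hom _ _ (conn _ _))) cy.
have q1 z : connect r z (e z) by apply: connect1; rewrite /= eqxx.
have q2 z : connect r z (n z) by apply: connect1; rewrite /= eqxx orbT.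
rewrite -(sdv_retract_phi x) -(sdv_retract_phi y).
apply: (connect_homo (r := r')); last exact: conn.
move=> u v /orP[] /eqP->; case: (sdv_cases u) => [[z ->]|->|->].
- rewrite sdv_retract_phi; case: (eqVneq z d) => [->|x1].
    by rewrite (sdv_ed h) sdv_retract_a.
  case: (eqVneq z (e d)) => [->|x2].
    by rewrite (sdv_eed h) sdv_retract_b -{2}[d](sdv_eK h).
  by rewrite (sdv_e h) // sdv_retract_phi.
- by rewrite sdv_ea sdv_retract_phi sdv_retract_a -{2}[d](sdv_eK h).
- by rewrite sdv_eb sdv_retract_phi sdv_retract_b.
- by rewrite (sdv_n h) !sdv_retract_phi.
- by rewrite (sdv_na h) sdv_retract_a sdv_retract_b -{2}[d](sdv_eK h).
- by rewrite (sdv_nb h) sdv_retract_a sdv_retract_b.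
Qed.

Lemma sdv_card_face x :
  #|porbit f' (phi x)| =
  #|porbit f x| + ((d \in porbit f x) + (e d \in porbit f x)).
Proof.
have ina y : (y \in porbit f' (phi x)) = (psi y \in porbit f x).
  rewrite !porbit_in -sdv_porbit_retract; apply/eqP/eqP; apply sdv_porbit_face.
rewrite (cardsD1 b) (cardsD1 a (_ :\ _)) !inE !ina sdv_retract_a sdv_retract_b (sdv_ab h).
rewrite -(card_imset _ (sdv_inj h)) addnA addnC; congr (_ + _).
apply: eq_card => y; rewrite !inE andbA -(sdv_codom h) ina.
apply/andP/imsetP => [[/codomP[z ->]]|[z zx ->]].
  by rewrite sdv_retract_phi; exists z.
by rewrite codom_f sdv_retract_phi.
Qed.

End Subdivided.

(** * Maps of darts that preserve faces and shared edges *)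

Lemma is_tree_transfer (T U : finType) (f : T -> U) (f' : U -> T)
    (S : {set T}) (S' : {set U}) (r : rel T) (r' : rel U) :
  (forall x, x \in S -> f x \in S' /\ f' (f x) = x) ->
  (forall y, y \in S' -> f' y \in S /\ f (f' y) = y) ->
  {in S &, forall x y, r x y = r' (f x) (f y)} ->
  is_tree S r -> is_tree S' r'.
Proof.
move=> hf hf' hr [S0 conn cyc]; split.
- case/set0Pn: S0 => x /hf[fx _]; by apply/set0Pn; exists (f x).
- move=> y z /hf'[Sy fy] /hf'[Sz fz]; rewrite -fy -fz.
  apply: (connect_homo (f := f)) (conn _ _ Sy Sz) => a b /and3P[Sa Sb rab].
  apply: connect1; rewrite /= -hr // rab andbT.
  by have [-> _] := hf _ Sa; have [-> _] := hf _ Sb.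
move=> c cS' /andP[cr uc]; rewrite -(size_map f'); apply: cyc.
  by move=> _ /mapP[y yc ->]; case: (hf' _ (cS' _ yc)).
apply/andP; split.
  rewrite cycle_map; apply: (sub_in_cycle (P := mem S') (e := r')) cr; last exact/allP.
  by move=> y z /hf'[Sy fy] /hf'[Sz fz] /=; rewrite hr // fy fz.
rewrite map_inj_in_uniq // => y z /cS'/hf'[_ fy] /cS'/hf'[_ fz] E.
by rewrite -fy -fz E.
Qed.

(* Satisfied by every composition of subdivisions of outer edges. *)
Record dart_map (G H : plane_graph) (phi : G -> H) : Prop := DartMap {
  dm_inj : injective phi;
  dm_face : forall x y, face_of (phi x) = face_of (phi y) <-> face_of x = face_of y;
  dm_surj : forall y, exists2 x, face_of y = face_of (phi x)
                               & face_of (edge H y) = face_of (phi (edge G x));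
  dm_edge : forall x, face_of (edge H (phi x)) = face_of (phi (edge G x));
  dm_outer : forall x, (phi x \in outer H) = (x \in outer G);
  dm_node : forall x, node H (phi x) = phi (node G x);
  dm_shared : forall y, shared y -> exists x, y = phi x
}.

Lemma dart_map_id (G : plane_graph) : dart_map (id : G -> G).
Proof. by split=> // y; exists y. Qed.

Lemma dart_map_comp (G H K : plane_graph) (phi : G -> H) (psi : H -> K) :
  dart_map phi -> dart_map psi -> dart_map (psi \o phi).
Proof.
move=> h1 h2; split=> /=.
- exact: inj_comp (dm_inj h2) (dm_inj h1).
- by move=> x y; split=> [/(dm_face h2)/(dm_face h1)|/(dm_face h1)/(dm_face h2)].
- move=> z; have [y fy fey] := dm_surj h2 z; have [x fx fex] := dm_surj h1 y.
  by exists x; [rewrite fy|rewrite fey]; apply/(dm_face h2).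
- by move=> x; rewrite (dm_edge h2); apply/(dm_face h2)/(dm_edge h1).
- by move=> x; rewrite (dm_outer h2) (dm_outer h1).
- by move=> x; rewrite (dm_node h2) (dm_node h1).
- move=> z shz; have [y yE] := dm_shared h2 shz.
  suff /(dm_shared h1)[x xE] : shared y by exists x; rewrite yE xE.
  move: shz; rewrite yE /shared (dm_outer h2) => /andP[-> /=].
  by rewrite (outer_of (dm_edge h2 y)) (dm_outer h2).
Qed.

Section DartMap.
Variables (G H : plane_graph) (phi : G -> H).
Hypothesis h : dart_map phi.

Lemma dm_sharedE x : shared (phi x) = shared x.
Proof.
by rewrite /shared (dm_outer h) (outer_of (dm_edge h x)) (dm_outer h).
Qed.

Lemma dm_outer_edge x : (edge H (phi x) \in outer H) = (edge G x \in outer G).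
Proof. by rewrite (outer_of (dm_edge h x)) (dm_outer h). Qed.

Lemma dm_bridgeless : bridgeless G <-> bridgeless H.
Proof.
split=> bl x.
  have [z -> ->] := dm_surj h x; apply/eqP => /(dm_face h) E.
  by have := bl z; rewrite E eqxx.
apply/eqP => /(dm_face h) E; have := bl (phi x).
by rewrite (dm_edge h) E eqxx.
Qed.

Lemma dm_inner_dual x y :
  inner_dual (face_of x) (face_of y) = inner_dual (face_of (phi x)) (face_of (phi y)).
Proof.
apply/inner_dualP/inner_dualP => -[z [shz fx fy ne]].
  exists (phi z); rewrite dm_sharedE (dm_edge h); split=> //; last 1 first.
  - by apply: contra_neq ne => /(dm_face h).
  - by apply/(dm_face h).
  - by apply/(dm_face h).
have [w zE] := dm_shared h shz; exists w.
move: shz fx fy; rewrite zE dm_sharedE (dm_edge h) => shw fx fy; split=> //.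
- by apply/(dm_face h).
- by apply/(dm_face h).
- by apply: contra_neq ne => /(dm_face h).
Qed.

Let fwd (F : {set G}) : {set H} :=
  if [pick x in F] is Some x then face_of (phi x) else set0.
Let bwd (F : {set H}) : {set G} := phi @^-1: F.

Let fwdE x : fwd (face_of x) = face_of (phi x).
Proof.
rewrite /fwd; case: pickP => [z|/(_ x)]; last by rewrite porbit_id.
by rewrite porbit_in => /eqP E; apply/(dm_face h).
Qed.

Lemma dm_preim x : phi @^-1: face_of (phi x) = face_of x.
Proof.
apply/setP => y; rewrite inE !porbit_in -!/(face_of _).
by apply/eqP/eqP => /(dm_face h).
Qed.

Lemma dm_tree : is_tree (inner_faces G) (@inner_dual G) <->
                is_tree (inner_faces H) (@inner_dual H).
Proof.
have fb F : F \in inner_faces G -> fwd F \in inner_faces H /\ bwd (fwd F) = F.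
  by case/inner_facesP => x xO ->; rewrite fwdE inner_facesE (dm_outer h) /bwd dm_preim.
have bf F : F \in inner_faces H -> bwd F \in inner_faces G /\ fwd (bwd F) = F.
  case/inner_facesP => y yO ->; have [x E _] := dm_surj h y.
  rewrite E /bwd dm_preim fwdE inner_facesE; split=> //.
  by rewrite -(dm_outer h) -(outer_of E).
split; [apply: (is_tree_transfer fb bf)|apply: (is_tree_transfer bf fb)].
  by move=> _ _ /inner_facesP[x _ ->] /inner_facesP[y _ ->]; rewrite !fwdE dm_inner_dual.
move=> F F' /bf[+ {1}<-] /bf[+ {1}<-].
by move=> /inner_facesP[x _ ->] /inner_facesP[y _ ->]; rewrite !fwdE dm_inner_dual.
Qed.

Lemma dm_shared_of x : shared_of (phi x) = phi @: shared_of x.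
Proof.
apply/setP => y; apply/in_shared_of/imsetP => [[fy shy]|[z /in_shared_of[fz shz] ->]].
  have [z yE] := dm_shared h shy; exists z => //; apply/in_shared_of.
  by rewrite -dm_sharedE -yE; split=> //; apply/(dm_face h); rewrite -yE.
by rewrite dm_sharedE; split=> //; apply/(dm_face h).
Qed.

(** Normality only compares colours of shared darts on one face, so the two colourings may differ
    there by a constant. *)
Lemma dm_normal (c : G -> bool) (c' : H -> bool) :
  (forall x y, shared x -> shared y -> face_of y = face_of x ->
     c x (+) c' (phi x) = c y (+) c' (phi y)) ->
  normal_darts c <-> normal_darts c'.
Proof.
move=> hc; have col x y : shared x -> shared y -> face_of y = face_of x ->
    (c x = c y) <-> (c' (phi x) = c' (phi y)).
  move=> sx sy fxy; have := hc _ _ sx sy fxy.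
  by case: (c x); case: (c y); case: (c' _); case: (c' _).
split=> nd x xO.
  have [z fz _] := dm_surj h x.
  have -> : shared_of x = shared_of (phi z).
    by apply/setP => y; apply/in_shared_of/in_shared_of; rewrite fz.
  rewrite dm_shared_of card_imset; last exact: dm_inj h.
  have zO : z \notin outer G by rewrite -(dm_outer h) -(outer_of fz).
  have [c3 hx] := nd z zO; split=> //.
  move=> _ _ _ /imsetP[y1 Y1 ->] /imsetP[y2 Y2 ->] /imsetP[y3 Y3 ->].
  rewrite !(inj_eq (dm_inj h)) => n1 n2 n3.
  have [[f1 s1] [f2 s2]] := (in_shared_of _ _ Y1, in_shared_of _ _ Y2).
  by apply/col => //; [rewrite f2|apply: (hx y1 y2 y3)].
have [|] := nd (phi x); first by rewrite (dm_outer h).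
rewrite dm_shared_of card_imset; last exact: dm_inj h.
move=> c3 hx; split=> // y1 y2 y3 Y1 Y2 Y3 n1 n2 n3.
have [[f1 s1] [f2 s2]] := (in_shared_of _ _ Y1, in_shared_of _ _ Y2).
apply/col => //; first by rewrite f2.
by apply: (hx _ _ (phi y3)); rewrite ?imset_f ?(inj_eq (dm_inj h)).
Qed.

End DartMap.

Section Subdivision.
Variables (G H : plane_graph) (d : G) (phi : G -> H).
Hypothesis hs : subdivision d phi.

Lemma subdivision_sdv : exists a b,
  subdivided (edge G) (node G) (edge H) (node H) phi d a b.
Proof.
case: hs => inj [a [b [ab cod [e1 e2 e3] [n1 n2 n3] _]]]; exists a, b; split=> //.
- exact: edgeK.
- exact: edge_neq.
- by move=> x x1 x2; apply: e3; rewrite edge_ofE !inE negb_or x1.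
- exact: edgeK.
Qed.

Lemma subdivision_outer x : (phi x \in outer H) = (x \in outer G).
Proof. by case: hs => _ [a [b [_ _ _ _ ->]]]. Qed.

(** The new darts lie on the two faces beside [d]. As one of these is outer, no new dart is
    shared. *)
Lemma subdivision_dart_map : (d \in outer G) || (edge G d \in outer G) -> dart_map phi.
Proof.
have [a [b sd]] := subdivision_sdv => dO.
have fed := sdv_porbit_edge sd.
have fa : face_of a = face_of (phi (edge G d)).
  by rewrite -(sdv_fed sd) -/(face H) face_of_face.
have fb : face_of b = face_of (phi d).
  by rewrite -(sdv_fd sd) -/(face H) face_of_face.
split.
- exact: sdv_inj sd.
- exact: sdv_porbit_face sd.
- move=> y; case: (sdv_cases sd y) => [[x ->]|->|->].
  + by exists x => //; apply: fed.
  + by exists (edge G d); rewrite // (sdv_ea sd) edgeK.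
  + by exists d; rewrite // (sdv_eb sd).
- exact: fed.
- exact: subdivision_outer.
- exact: sdv_n sd.
- move=> y; case: (sdv_cases sd y) => [[x ->]|->|->]; first by exists x.
    rewrite /shared (sdv_ea sd) (outer_of fa) !subdivision_outer.
    by case/orP: dO => ->; rewrite ?andbF.
  rewrite /shared (sdv_eb sd) (outer_of fb) !subdivision_outer.
  by case/orP: dO => ->; rewrite ?andbF.
Qed.

Lemma cover_push_edges (Q : {set {set G}}) z :
  reflect (exists2 x, x \in cover Q & z = phi x \/ z = edge H (phi x))
          (z \in cover (push_edges phi Q)).
Proof.
apply: (iffP bigcupP) => [[_ /imsetP[x xQ ->]]|[x xQ zE]].
  by rewrite edge_ofE !inE => zE; exists x => //; case/orP: zE => /eqP; [left|right].
exists (edge_of (phi x)); first exact: imset_f.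
by rewrite edge_ofE !inE; case: zE => ->; rewrite eqxx ?orbT.
Qed.

End Subdivision.

(** * Invariance of normality under Transformation 1 *)

Definition outer_cover (G : plane_graph) (P : {set {set G}}) :=
  {in cover P, forall z, (z \in outer G) || (edge G z \in outer G)}.

Lemma edge_of_cover (G : plane_graph) (P : {set {set G}}) (d : G) :
  edge_of d \in P -> d \in cover P /\ edge G d \in cover P.
Proof.
move=> dP; split; apply/bigcupP; exists (edge_of d) => //;
by rewrite edge_ofE !inE eqxx ?orbT.
Qed.

Lemma outer_cover_pull (G H : plane_graph) (d : G) (phi : G -> H) Q :
  subdivision d phi -> outer_cover (push_edges phi Q) -> outer_cover Q.
Proof.
move=> hs oQ z zQ; have: phi z \in cover (push_edges phi Q).
  by apply/cover_push_edges; exists z => //; left.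
move/oQ; rewrite (subdivision_outer hs).
have [a [b sd]] := subdivision_sdv hs.
by rewrite [edge H _ \in _](outer_of (sdv_porbit_edge sd z)) (subdivision_outer hs).
Qed.

Lemma subdivisions_outer_pull (G : plane_graph) P n H Q :
  @subdivisions G P n H Q -> outer_cover Q -> outer_cover P.
Proof.
elim=> // {}n {}H K {}Q d phi _ IH dQ hs oQ.
exact/IH/(outer_cover_pull hs).
Qed.

(** The last two clauses find edges that were not subdivided: from the complement of [Q] if the
    segment is given in [H], from that of [P] if it is given in [G]. The latter assumes closure
    under [edge], since an arbitrary [P] may cover a single dart of an edge. *)
Lemma subdivisions_dart_map (G : plane_graph) P n H Q :
  @subdivisions G P n H Q -> outer_cover P ->
  exists phi : G -> H,
    [/\ dart_map phi, outer_cover Q,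
        (forall z, phi z \notin cover Q -> edge H (phi z) = phi (edge G z))
      & {in cover P, forall z, edge G z \in cover P} ->
        {in cover Q, forall z, edge H z \in cover Q} /\
        forall z, z \notin cover P ->
          edge H (phi z) = phi (edge G z) /\ phi z \notin cover Q].
Proof.
elim=> [oP|{}n {}H K {}Q d psi _ IH dQ hs /IH[phi [dm oQ b1 b2]]].
  by exists id; split=> //; apply: dart_map_id.
have [dcQ edcQ] := edge_of_cover dQ.
have [a [b sd]] := subdivision_sdv hs.
have dm' := subdivision_dart_map hs (oQ _ dcQ).
have nd w : w \notin cover Q -> edge K (psi w) = psi (edge H w).
  by move=> wQ; apply: (sdv_e sd); apply: contraNneq wQ => ->.
exists (psi \o phi); split.
- exact: dart_map_comp.
- move=> z /cover_push_edges[x xQ zE]; have := oQ _ xQ.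
  case: zE => ->; rewrite ?edgeK (dm_outer dm') (dm_outer_edge dm') //.
  by rewrite orbC.
- move=> z /= zQ; have wQ : phi z \notin cover Q.
    by apply: contra zQ => wQ; apply/cover_push_edges; exists (phi z) => //; left.
  by rewrite nd // b1.
move=> /b2[clQ h]; split.
  move=> z /cover_push_edges[x xQ zE]; apply/cover_push_edges; exists x => //.
  by case: zE => ->; [right|left; rewrite edgeK].
move=> z /h[E wQ] /=; rewrite nd // E; split=> //.
apply/negP => /cover_push_edges[x xQ []].
  by move/(dm_inj dm') => E'; rewrite E' xQ in wQ.
case: (eqVneq x d) => [->|x1].
  by rewrite (sdv_ed sd) => E'; have := sdv_phi_a sd (phi z); rewrite E' eqxx.
case: (eqVneq x (edge H d)) => [->|x2].
  by rewrite (sdv_eed sd) => E'; have := sdv_phi_b sd (phi z); rewrite E' eqxx.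
rewrite (sdv_e sd) // => /(dm_inj dm') E'.
by rewrite E' clQ in wQ.
Qed.

Lemma segment_cover (G : plane_graph) (P : {set {set G}}) : boundary_segment P ->
  forall z, (z \in cover P) = (edge_of z \in P).
Proof.
case=> F [e0 [FI e0B PE]] z; apply/bigcupP/idP => [[e eP ze]|zP]; last first.
  by exists (edge_of z) => //; apply: porbit_id.
suff: e \in edges G.
  by move=> eE; rewrite (porbits_porbit _ eE) in ze; rewrite /edge_of (eqP ze).
have: e \in face_edges F :&: face_edges (outer G).
  move: eP; rewrite PE inE => /connectP[p]; case/lastP: p => [|p t]; first by move=> _ ->.
  by rewrite rcons_path last_rcons => /andP[_ /and3P[_ ? _]] ->.
by rewrite inE => /andP[/imsetP[x _ ->]] _; apply: porbit_mem_porbits.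
Qed.

Lemma segment_outer (G : plane_graph) (P : {set {set G}}) :
  boundary_segment P -> outer_cover P.
Proof.
move=> hP z; rewrite (segment_cover hP); case: hP => F [e0 [FI e0B ->]].
rewrite inE => /connectP[p pth zE].
have: edge_of z \in face_edges F :&: face_edges (outer G).
  case/lastP: p pth zE => [|p t]; first by move=> _ ->.
  by rewrite rcons_path last_rcons => /andP[_ /and3P[_ ? _]] ->.
rewrite inE => /andP[_ /imsetP[x xO /edge_of_inj[]E]]; rewrite -E xO ?orbT //.
Qed.

Lemma cers_coloring (G : plane_graph) : cers_darts G -> exists c : G -> bool, dart_coloring c.
Proof. by case=> _ /even_facesP. Qed.

(** The sum [t] of the colours of a dart and of its image does not change when a face walk steps
    over an edge that was not subdivided. By [segment_arc] it therefore agrees at any two shared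
    darts of a face. The disjunction covers both directions of Transformation 1. *)
Lemma subdivisions_normal (G H : plane_graph) P n Q : cers G -> cers H ->
  @subdivisions G P n H Q -> boundary_segment P \/ boundary_segment Q ->
  normal_cers G <-> normal_cers H.
Proof.
move=> /cersP cG /cersP cH sub seg.
have oP : outer_cover P.
  by case: seg => /segment_outer //; apply: subdivisions_outer_pull sub.
have [phi [dm oQ bP bQ]] := subdivisions_dart_map sub oP.
have [c hc] := cers_coloring cG; have [c' hc'] := cers_coloring cH.
have [cn ce] := hc; have [cn' ce'] := hc'.
apply: (iff_trans (normal_cersP cG hc)).
apply: iff_trans (iff_sym (normal_cersP cH hc')); apply: (dm_normal dm).
pose t z := c z (+) c' (phi z); rewrite -/(t _).
have tf z : edge H (phi z) = phi (edge G z) -> t (face G z) = t z.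
  move=> E; rewrite /t faceE cn -(dm_node dm) cn' -E ce ce'.
  by rewrite addNb addbN negbK.
have arcP x y : boundary_segment P -> shared x -> shared y ->
    face_of y = face_of x -> t x = t y.
  move=> hP sx sy fxy.
  have cl : {in cover P, forall z, edge G z \in cover P}.
    by move=> z; rewrite !(segment_cover hP) edge_of_edge.
  have [_ nP] := bQ cl.
  have go k u : (forall i, i < k -> edge_of (iter i (face G) u) \notin P) ->
      t (iter k (face G) u) = t u.
    elim: k => // k IH hk; rewrite iterS tf.
      by apply: IH => i ik; apply: hk; apply: ltnW.
    by apply: (nP _ _).1; rewrite (segment_cover hP) hk.
  by have [[k -> /go->]|[k -> /go->]] := segment_arc cG hP sx sy fxy.
have arcQ x y : boundary_segment Q -> shared x -> shared y ->
    face_of y = face_of x -> t x = t y.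
  move=> hQ sx sy fxy.
  (* Here the arc is found in [H]; while it avoids [Q], it is the image, dart by dart, of an arc in
     [G]. *)
  have go k u : (forall i, i < k -> edge_of (iter i (face H) (phi u)) \notin Q) ->
      iter k (face H) (phi u) = phi (iter k (face G) u) /\ t (iter k (face G) u) = t u.
    elim: k => // k IH hk; have [|E1 E2] := IH; first by move=> i ik; apply: hk; apply: ltnW.
    have E3 : edge H (phi (iter k (face G) u)) = phi (edge G (iter k (face G) u)).
      by apply: bP; rewrite -E1 (segment_cover hQ) hk.
    rewrite !iterS tf // E1 E2; split=> //.
    by rewrite !faceE E3 (dm_node dm).
  have fxy' : face_of (phi y) = face_of (phi x) by apply/(dm_face dm).
  have := segment_arc cH hQ _ _ fxy'; rewrite !(dm_sharedE dm) => /(_ sx sy).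
  case=> -[k kE /go[]]; rewrite -kE => /(dm_inj dm) <- //.
by case: seg => hS x y; [apply: arcP|apply: arcQ].
Qed.

Lemma transformation1_normal (G H : plane_graph) : cers G -> cers H ->
  transformation1 G H -> normal_cers G <-> normal_cers H.
Proof.
move=> cG cH [[n [P [Q [seg _ sub]]]]|[n [P [Q [seg _ sub]]]]].
  by apply: subdivisions_normal sub _ => //; left.
by apply: iff_sym; apply: subdivisions_normal sub _ => //; right.
Qed.

Lemma obtained_from_normal (G H : plane_graph) :
  obtained_from H G -> normal_cers G <-> normal_cers H.
Proof.
elim=> [A B [cA cB]|A|A B C _ h1 _ h2]; [exact: transformation1_normal|by []|].
exact: iff_trans h1 h2.
Qed.

Lemma catacondensed_benzenoid_normal (H : plane_graph) :
  catacondensed_benzenoid H -> normal_cers H.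
Proof.
case=> /cersP cH h6; have [c hc] := cers_coloring cH.
by apply/(normal_cersP cH hc); apply: benzenoid_normal.
Qed.

(** * Reduction to hexagons *)

Section Step.
Variables (G H : plane_graph) (d : G) (phi : G -> H).
Hypothesis hs : subdivision d phi.

Lemma subdivision_outer_edge x : (edge H (phi x) \in outer H) = (edge G x \in outer G).
Proof.
have [a [b sd]] := subdivision_sdv hs.
by rewrite (outer_of (sdv_porbit_edge sd x)) (subdivision_outer hs).
Qed.

Lemma subdivision_vertex x y :
  vertex_of (phi x) = vertex_of (phi y) <-> vertex_of x = vertex_of y.
Proof. by have [a [b sd]] := subdivision_sdv hs; apply: (sdv_porbit_node sd). Qed.

Lemma subdivision_card_face x :
  #|face_of (phi x)| = #|face_of x| + ((d \in face_of x) + (edge G d \in face_of x)).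
Proof. by have [a [b sd]] := subdivision_sdv hs; apply: (sdv_card_face sd). Qed.

Lemma subdivision_degree23 : (d \in outer G) || (edge G d \in outer G) ->
  degree23 G <-> degree23 H.
Proof.
have [a [b sd]] := subdivision_sdv hs => dO.
have inj := sdv_inj sd; have nE := sdv_n sd.
split=> deg x; last first.
  have [] := deg (phi x); rewrite !nE !(inj_eq inj) !(subdivision_outer hs) => nx [].
    by case=> /inj n2 hO; split=> //; left.
  by move=> /inj n3; split=> //; right.
case: (sdv_cases sd x) => [[z ->]|->|->].
- rewrite !nE !(inj_eq inj) !(subdivision_outer hs).
  by have [nz [[-> hO]|->]] := deg z; split=> //; [left|right].
- have fa : face_of a = face_of (phi (edge G d)).
    by rewrite -(sdv_fed sd) -/(face H) face_of_face.
  have fb : face_of b = face_of (phi d).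
    by rewrite -(sdv_fd sd) -/(face H) face_of_face.
  rewrite !(sdv_na sd, sdv_nb sd) eq_sym (sdv_ab sd); split=> //; left; split=> //.
  by rewrite (outer_of fa) (outer_of fb) !(subdivision_outer hs) orbC.
- have fa : face_of a = face_of (phi (edge G d)).
    by rewrite -(sdv_fed sd) -/(face H) face_of_face.
  have fb : face_of b = face_of (phi d).
    by rewrite -(sdv_fd sd) -/(face H) face_of_face.
  rewrite !(sdv_na sd, sdv_nb sd) (sdv_ab sd); split=> //; left; split=> //.
  by rewrite (outer_of fa) (outer_of fb) !(subdivision_outer hs).
Qed.

Lemma subdivision_simple : simple_graph G -> simple_graph H.
Proof.
have [a [b sd]] := subdivision_sdv hs => -[sl sm].
have vb : vertex_of b = vertex_of a by rewrite -(sdv_na sd) vertex_of_node.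
have va x : vertex_of (phi x) != vertex_of a.
  rewrite -porbit_in (sdv_porbit_new sd).
  by rewrite (negPf (sdv_phi_a sd x)) (negPf (sdv_phi_b sd x)).
have vaN x : vertex_of a = vertex_of (phi x) -> False.
  by move=> E; have := va x; rewrite E eqxx.
have slN x : vertex_of x = vertex_of (edge G x) -> False.
  by move=> E; have := sl x; rewrite E eqxx.
have ends x : [\/ x = d /\ edge H (phi x) = a, x = edge G d /\ edge H (phi x) = b
               | edge H (phi x) = phi (edge G x)].
  case: (eqVneq x d) => [->|x1]; first by constructor 1; rewrite (sdv_ed sd).
  case: (eqVneq x (edge G d)) => [->|x2]; first by constructor 2; rewrite (sdv_eed sd).
  by constructor 3; rewrite (sdv_e sd).
split=> [y|y y'].
  apply/eqP; case: (sdv_cases sd y) => [[x ->]|->|->].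
  - case: (ends x) => [[_ ->]|[_ ->]|->]; rewrite ?vb; [exact: vaN|exact: vaN|].
    by move/subdivision_vertex/esym/slN.
  - by rewrite (sdv_ea sd) => /esym/vaN.
  - by rewrite (sdv_eb sd) vb => /esym/vaN.
case: (sdv_cases sd y) => [[x ->]|->|->]; case: (sdv_cases sd y') => [[x' ->]|->|->];
  rewrite ?vb ?(sdv_ea sd) ?(sdv_eb sd) //.
- move/subdivision_vertex => E.
  case: (ends x) => [[xE ->]|[xE ->]|->]; case: (ends x') => [[xE' ->]|[xE' ->]|->];
    rewrite ?vb ?xE ?xE' //.
  + by move: E; rewrite xE xE' => /slN.
  + by move/vaN.
  + by move: E; rewrite xE xE' => /esym/slN.
  + by move/vaN.
  + by move=> /esym/vaN.
  + by move=> /esym/vaN.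
  by move/subdivision_vertex => E'; rewrite (sm _ _ E E').
- by move/esym/vaN.
- by move/esym/vaN.
- by move/vaN.
- by move=> _ /subdivision_vertex/slN.
- by move/vaN.
- by move=> _ /subdivision_vertex/esym/slN.
Qed.

(** The edge set to start from when a smoothing is read backwards; it is pushed to [Q] again if [Q]
    contains both halves of the subdivided edge. *)
Definition pull_edges (Q : {set {set H}}) : {set {set G}} :=
  [set edge_of z | z in [set z | edge_of (phi z) \in Q]].

Lemma push_pull_edges (Q : {set {set H}}) : Q \subset edges H -> edge_of (phi d) \in Q ->
  edge_of (phi (edge G d)) \in Q -> push_edges phi (pull_edges Q) = Q.
Proof.
have [a [b sd]] := subdivision_sdv hs => QE dQ edQ.
have cov x : edge_of (phi x) \in Q -> edge_of (phi x) \in push_edges phi (pull_edges Q).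
  move=> xQ; apply: imset_f; apply/bigcupP; exists (edge_of x); last exact: porbit_id.
  by apply: imset_f; rewrite inE.
apply/setP => E; apply/idP/idP => [/imsetP[x /bigcupP[_ /imsetP[z zQ ->] xz] ->]|EQ].
  move: xz; move: zQ; rewrite inE => zQ; rewrite edge_ofE !inE => /orP[]/eqP-> //.
  case: (eqVneq z d) => [->//|z1]; case: (eqVneq z (edge G d)) => [->|z2].
    by rewrite edgeK.
  by rewrite -(sdv_e sd) // edge_of_edge.
have /porbitsP[y yE] := subsetP QE _ EQ; rewrite -/(edge_of y) in yE.
case: (sdv_cases sd y) => [[x xE]|xE|xE]; rewrite xE in yE.
- by rewrite yE; apply: cov; rewrite -yE.
- by rewrite yE -edge_of_edge (sdv_ea sd); apply: cov.
- by rewrite yE -edge_of_edge (sdv_eb sd); apply: cov.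
Qed.

End Step.

(** * Parallel edges, and subdividing a boundary edge twice *)

Section Parallel.
Variable G : plane_graph.
Implicit Types x y z d : G.
Hypothesis bl : bridgeless G.
Hypothesis deg : degree23 G.
Hypothesis tri : dual_triangle_free G.

(** Controls the parallel edges that smoothing could create. If the face of [d] were not a digon,
    the third darts at the two ends would give a bridge or two different edges between the same pair
    of inner faces. *)
Lemma parallel_digon d x : d \notin outer G -> edge G d \in outer G -> x != d ->
  vertex_of x = vertex_of d -> vertex_of (edge G x) = vertex_of (edge G d) ->
  face G (face G d) = d.
Proof.
move=> dO edO xd vx vex.
have nbl z : face_of (edge G z) = face_of z -> False.
  by move=> E; have := bl z; rewrite E eqxx.
have fd : face G d = node G (edge G d) := faceE d.
have n3' : edge G x != face G d ->
    node G (edge G x) = edge G d /\ node G (face G d) = edge G x.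
  move=> B; have [E|E|E] := degree23_cases deg vex.
  - by move/edge_inj: E xd => ->; rewrite eqxx.
  - by rewrite fd E eqxx in B.
  - rewrite -E; split=> //; have [_ [[n2 _]|n3]] := deg (edge G x).
      by move: B; rewrite fd E n2 eqxx.
    by rewrite fd E n3.
have [A|A] := eqVneq (node G x) d.
  have [B|/n3'[_ nz]] := eqVneq (edge G x) (face G d).
    by rewrite -B face_edge.
  case: (nbl (face G d)).
  by rewrite -face_of_node nz face_of_face -face_of_node A.
have [xE n3] : x = node G d /\ node G (node G x) = d.
  have [E|E|E] := degree23_cases deg vx.
  - by rewrite E eqxx in xd.
  - by split=> //; have [_ [[n2 _]|//]] := deg d; rewrite E ?n2 ?eqxx // in A *.
  - by rewrite -E eqxx in A.
set z := node G x in A n3.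
have fz : face_of z = face_of (edge G x) by rewrite face_of_node.
have fez : face_of (edge G z) = face_of d by rewrite -face_of_node n3.
have [B|/n3'[ex nz]] := eqVneq (edge G x) (face G d).
  by case: (nbl z); rewrite fez fz B face_of_face.
have fefd : face_of (edge G (face G d)) = face_of (edge G x) by rewrite -face_of_node nz.
have xO : x \in outer G by rewrite xE (outer_of (face_of_node d)).
have exO : edge G x \notin outer G.
  by apply/negP => h; case: (nbl x); move: h xO; rewrite !outerE => /eqP-> /eqP->.
have sh : shared (face G d).
  by rewrite /shared outer_face_dart dO (outer_of fefd).
have E : edge G z = face G d.
  by apply: shared_unique => //; rewrite ?face_of_face // edgeK fz fefd.
by rewrite -E face_edge n3.
Qed.
End Parallel.

(** This is |m - 6|, written with truncated subtractions. *)
Definition hexagon_defect m := (m - 6) + (6 - m).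

Definition total_defect (G : plane_graph) :=
  \sum_(F in inner_faces G) hexagon_defect #|F|.

Section DoubleStep.
Variables (G H K : plane_graph) (d : G) (phi : G -> H) (psi : H -> K).
Hypotheses (s1 : subdivision d phi) (s2 : subdivision (phi d) psi).
Hypotheses (dO : d \notin outer G) (edO : edge G d \in outer G).

Let ou1 : (d \in outer G) || (edge G d \in outer G).
Proof. by rewrite edO orbT. Qed.

Let ou2 : (phi d \in outer H) || (edge H (phi d) \in outer H).
Proof. by rewrite (subdivision_outer_edge s1) edO orbT. Qed.

Let m1 : dart_map phi := subdivision_dart_map s1 ou1.
Let m2 : dart_map psi := subdivision_dart_map s2 ou2.
Let m12 : dart_map (psi \o phi) := dart_map_comp m1 m2.

Lemma double_card_face x : #|face_of (psi (phi x))| =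
  #|face_of x| + ((d \in face_of x) + (edge G d \in face_of x)).*2.
Proof.
rewrite (subdivision_card_face s2) (subdivision_card_face s1) -addnA -addnn.
congr (_ + (_ + (_ + _))); rewrite !porbit_in -!/(face_of _).
  by congr nat_of_bool; apply/eqP/eqP => /(dm_face m1).
by congr nat_of_bool; rewrite (dm_edge m1); apply/eqP/eqP => /(dm_face m1).
Qed.

Lemma double_even_faces : even_faces G <-> even_faces K.
Proof.
split=> ev x.
  by have [z -> _] := dm_surj m12 x; rewrite double_card_face oddD odd_double addbF.
by have := ev (psi (phi x)); rewrite double_card_face oddD odd_double addbF.
Qed.

Lemma double_cers : cers_darts G -> cers_darts K.
Proof.
case=> si ev bl dg tr; split.
- exact/(subdivision_simple s2)/(subdivision_simple s1).
- exact/double_even_faces.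
- exact/(dm_bridgeless m12).
- by apply/(subdivision_degree23 s2 ou2)/(subdivision_degree23 s1 ou1).
- exact/(dm_tree m12).
Qed.

(** The point is simplicity. The colouring excludes loops, parallel edges other than that of [d]
    would persist in [K], and an edge parallel to [d] would make its face a digon. *)
Lemma double_cers_inv : 2 < #|face_of d| -> cers_darts K -> cers_darts G.
Proof.
move=> d2 [[slK smK] ev /(dm_bridgeless m12) bl dgK /(dm_tree m12) tr].
have dg : degree23 G.
  by apply/(subdivision_degree23 s1 ou1)/(subdivision_degree23 s2 ou2).
have evG : even_faces G by apply/double_even_faces.
split=> //; have [c [cn ce]] := (even_facesP G).1 evG.
split=> [x|x x' vx vex].
  apply/eqP => E; have := ce x; rewrite -!(at_vertexE cn) E.
  by case: at_vertex.
have key y : y != d -> vertex_of y = vertex_of d ->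
    vertex_of (edge G y) = vertex_of (edge G d) -> False.
  move=> yd vy vey.
  have ff := parallel_digon bl dg (tree_triangle_free tr) dO edO yd vy vey.
  have /(iter_porbit_inj d2) := (ff : iter 2 (face G) d = iter 0 (face G) d).
  by rewrite (ltn_trans _ d2) // => /(_ isT).
have key' y : y != edge G d -> vertex_of y = vertex_of (edge G d) ->
    vertex_of (edge G y) = vertex_of d -> False.
  move=> yd vy vey; apply: (key (edge G y)) => //; last by rewrite edgeK.
  by rewrite edge_eq.
apply/eqP; case: (eqVneq x x') => // xx'; exfalso.
have [xd|x1] := eqVneq x d.
  by apply: (key x'); rewrite -xd // eq_sym.
have [xd'|x1'] := eqVneq x' d.
  by apply: (key x); rewrite -xd'.
have [xd|x2] := eqVneq x (edge G d).
  by apply: (key' x'); rewrite -?xd -?vx -?vex // ?xd ?edgeK // eq_sym -xd.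
have [xd'|x2'] := eqVneq x' (edge G d).
  by apply: (key' x); rewrite -?xd' -?vx -?vex // ?vx ?vex ?xd' ?edgeK // -?xd'.
have [a1 [b1 sd1]] := subdivision_sdv s1; have [a2 [b2 sd2]] := subdivision_sdv s2.
have e12 y : y != d -> y != edge G d -> edge K (psi (phi y)) = psi (phi (edge G y)).
  move=> y1 y2; rewrite (sdv_e sd2); first by rewrite (sdv_e sd1).
    by rewrite (inj_eq (dm_inj m1)).
  by rewrite (sdv_ed sd1) (sdv_phi_a sd1).
have := smK (psi (phi x)) (psi (phi x')); rewrite !e12 //.
have v12 y y' : vertex_of y = vertex_of y' ->
    vertex_of (psi (phi y)) = vertex_of (psi (phi y')).
  by move=> E; apply/(subdivision_vertex s2)/(subdivision_vertex s1).
move=> /(_ (v12 _ _ vx) (v12 _ _ vex)) /(dm_inj m2) /(dm_inj m1) E.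
by rewrite E eqxx in xx'.
Qed.

(** The other side of [d] is outer, so only one inner face changes its size. The additive form
    avoids truncated subtraction. *)
Lemma double_total_defect :
  total_defect K + hexagon_defect #|face_of d| =
  total_defect G + hexagon_defect (#|face_of d| + 2).
Proof.
pose pre (F : {set K}) : {set G} := (psi \o phi) @^-1: F.
have pE x : pre (face_of (psi (phi x))) = face_of x := dm_preim m12 x.
have rep F : F \in inner_faces K -> exists2 x, x \notin outer G & F = face_of (psi (phi x)).
  case/inner_facesP => y yO ->; have [x E _] := dm_surj m12 y; exists x => //.
  by rewrite -(dm_outer m12) -(outer_of E).
have preG : inner_faces G = pre @: inner_faces K.
  apply/setP => F; apply/idP/imsetP => [/inner_facesP[x xO ->]|[_ /rep[x xO ->] ->]].
    by exists (face_of (psi (phi x))); rewrite ?pE // inner_facesE (dm_outer m12).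
  by rewrite pE inner_facesE.
have preI : {in inner_faces K &, injective pre}.
  by move=> _ _ /rep[x _ ->] /rep[y _ ->]; rewrite !pE => /(dm_face m12).
rewrite /total_defect preG big_imset //=.
pose F0 := face_of (psi (phi d)).
have F0K : F0 \in inner_faces K by rewrite inner_facesE (dm_outer m12).
rewrite (bigD1 F0 F0K) [in RHS](bigD1 F0 F0K) /= pE.
have -> : #|F0| = #|face_of d| + 2.
  rewrite double_card_face porbit_id porbit_in -!/(face_of _) /=.
  suff -> : (face_of (edge G d) == face_of d) = false by [].
  by apply/eqP => E; have := edO; rewrite (outer_of E) (negPf dO).
rewrite addnAC [RHS]addnAC; congr (_ + _); first exact: addnC.
apply: eq_bigr.
move=> _ /andP[/rep[x xO ->] ne]; rewrite pE double_card_face !porbit_in -!/(face_of _).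
have -> : (face_of d == face_of x) = false.
  by apply/negbTE; apply: contra_neq ne => E; apply/(dm_face m12).
suff -> : (face_of (edge G d) == face_of x) = false by rewrite addn0.
by apply/eqP => E; have := edO; rewrite (outer_of E) (negPf xO).
Qed.

End DoubleStep.

(** * The boundary segment through a given edge *)

Definition segment_at (G : plane_graph) (d : G) : {set {set G}} :=
  let B := face_edges (face_of d) :&: face_edges (outer G) in
  [set f | connect [rel a b | [&& a \in B, b \in B & line_adj a b]] (edge_of d) f].

Section Segment.
Variable G : plane_graph.
Implicit Types d x : G.

Lemma boundary_edge d : edge G d \in outer G ->
  edge_of d \in face_edges (face_of d) :&: face_edges (outer G).
Proof.
move=> edO; rewrite inE; apply/andP; split; apply/imsetP.
  by exists d => //; apply: porbit_id.
by exists (edge G d) => //; rewrite edge_of_edge.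
Qed.

Lemma segment_at_boundary d : d \notin outer G -> edge G d \in outer G ->
  boundary_segment (segment_at d).
Proof.
move=> dO edO; exists (face_of d), (edge_of d); split=> //.
  by rewrite inner_facesE.
exact: boundary_edge.
Qed.

Lemma segment_at_id d : edge_of d \in segment_at d.
Proof. by rewrite inE connect0. Qed.

Lemma segment_at_next d x : face_of x = face_of d ->
  edge G x \in outer G -> edge G (face G x) \in outer G ->
  edge_of x != edge_of (face G x) ->
  edge_of x \in segment_at d -> edge_of (face G x) \in segment_at d.
Proof.
move=> fx exO efxO ne; rewrite !inE => h; apply: connect_trans h (connect1 _).
apply/and3P; split.
- by rewrite -fx boundary_edge.
- by rewrite -fx -(face_of_face x) boundary_edge.
apply/and4P; split=> //; try exact: porbit_mem_porbits.
apply/set0Pn; exists (vertex_of (face G x)).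
by rewrite inE !endpointsE !inE -vertex_of_face eqxx orbT.
Qed.

End Segment.

(** * Existence of subdivisions and smoothings *)

Lemma exists_subdivision (G : plane_graph) (d : G) :
  exists (H : plane_graph) (phi : G -> H), subdivision d phi.
Proof.
(* The new darts are [None], in the role of [a], and [Some None], in the role of [b]. *)
pose U : finType := option (option G).
pose phi (x : G) : U := Some (Some x).
pose ef (y : U) : U := match y with
  | None => phi d
  | Some None => phi (edge G d)
  | Some (Some x) => if x == d then None else if x == edge G d then Some None
                     else phi (edge G x)
  end.
pose nf (y : U) : U := match y with
  | None => Some None | Some None => None | Some (Some x) => phi (node G x) end.
have efK : involutive ef.
  case=> [[x|]|] /=; last 2 first.
  - by rewrite (negPf (edge_neq d)) eqxx.
  - by rewrite eqxx.
  case: (eqVneq x d) => [->//|x1]; case: (eqVneq x (edge G d)) => [->//|x2] /=.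
  by rewrite edge_eq (negPf x2) (inj_eq (@edge_inj G)) (negPf x1) edgeK.
have nfI : injective nf.
  by case=> [[x|]|] [[y|]|] //= [] /perm_inj ->.
pose e' := perm (inv_inj efK); pose n' := perm nfI.
have sd : subdivided (edge G) (node G) e' n' phi d None (Some None).
  split=> //; rewrite ?/e' ?/n'.
  - exact: edgeK.
  - exact: edge_neq.
  - by move=> x y [].
  - case=> [[x|]|] //=; first by rewrite codom_f.
      by apply/codomP => -[].
    by apply/codomP => -[].
  - by rewrite permE /= eqxx.
  - by rewrite permE /= (negPf (edge_neq d)) eqxx.
  - by move=> x x1 x2; rewrite permE /= (negPf x1) (negPf x2).
  - by rewrite permE.
  - by rewrite permE.
  - by move=> x; rewrite permE.
  - by move=> y; rewrite !permE efK.
have /porbitsP[x0 oE] := outer_face G.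
have eK' : involutive e' := sdv_e'K sd.
have conn := (sdv_connected sd).1 (@dart_connected G).
have eul : #|porbits n'| + #|porbits (e' * n')%g| = #|porbits e'| + 2.
  by apply/eqP; rewrite (sdv_euler sd) euler_formula.
pose H := PlaneGraph eK' (sdv_e'n sd) conn eul (porbit_mem_porbits (e' * n')%g (phi x0)).
exists H, phi; split; first exact: sdv_inj sd.
exists None, (Some None); split.
- by [].
- exact: sdv_codom sd.
- split; [exact: sdv_ed sd|exact: sdv_eed sd|].
  by move=> x; rewrite edge_ofE !inE negb_or => /andP[]; apply: (sdv_e sd).
- by split; [exact: sdv_na sd|exact: sdv_nb sd|exact: sdv_n sd].
move=> x; rewrite oE !porbit_in.
by apply/eqP/eqP => /(sdv_porbit_face sd).
Qed.

(** The hypotheses say that [a] and [b] are the darts at a vertex of degree 2 that carries no loop.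
    Connectedness and Euler's formula are read backwards through [sdv_connected] and [sdv_euler]. *)
Lemma exists_smoothing (K : plane_graph) (a b : K) :
  a != b -> edge K a != b -> node K a = b -> node K b = a ->
  exists (H : plane_graph) (phi : H -> K) (d : H), subdivision d phi /\ phi d = edge K a.
Proof.
move=> ab eab na nb.
pose A := [pred y : K | (y != a) && (y != b)].
pose T : finType := {y : K | A y}.
pose mk y (yA : A y) : T := exist (fun z => is_true (A z)) y yA.
have eba : edge K b != a by rewrite edge_eq eq_sym.
(* The reverses of [a] and [b] become the two darts of the merged edge. *)
pose ef (y : K) := if edge K y == a then edge K b
                   else if edge K y == b then edge K a else edge K y.
have efA (x : T) : A (ef (val x)).
  case: x => y /= /andP[ya yb]; rewrite /ef.
  case: ifP => [_|/negbT y1]; first by rewrite eba edge_neq.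
  case: ifP => [_|/negbT y2]; first by rewrite eab edge_neq.
  by rewrite y1 y2.
have nA (x : T) : A (node K (val x)).
  case: x => y /= /andP[ya yb]; apply/andP; split; apply/eqP => E.
    by case/eqP: yb; apply: (@perm_inj _ (node K)); rewrite E nb.
  by case/eqP: ya; apply: (@perm_inj _ (node K)); rewrite E na.
pose eT (x : T) : T := mk _ (efA x).
pose nT (x : T) : T := mk _ (nA x).
have eTK : involutive eT.
  case=> y yA; apply: val_inj => /=; case/andP: (yA) => ya yb; rewrite /ef.
  case: (eqVneq (edge K y) a) => [E|y1].
    by rewrite edgeK eq_sym (negPf ab) eqxx -E edgeK.
  case: (eqVneq (edge K y) b) => [E|y2]; first by rewrite edgeK eqxx -E edgeK.
  by rewrite edgeK (negPf ya) (negPf yb).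
have nTI : injective nT.
  by move=> x y /(congr1 val) /= /perm_inj /val_inj.
pose e := perm (inv_inj eTK); pose n := perm nTI.
have eaA : A (edge K a) by rewrite /= edge_neq eab.
have ebA : A (edge K b) by rewrite /= edge_neq eba.
pose d : T := mk _ eaA.
have edE : val (e d) = edge K b by rewrite permE /= /ef edgeK eqxx.
have sd : subdivided e n (edge K) (node K) (val : T -> K) d a b.
  split=> //.
  - by move=> x; rewrite !permE eTK.
  - move=> x; rewrite permE -(inj_eq val_inj) /=; case: x => y /= /andP[ya yb]; rewrite /ef.
    case: (eqVneq (edge K y) a) => [E|y1].
      by apply: contraNneq ab => E'; rewrite -E -E' edgeK.
    case: (eqVneq (edge K y) b) => [E|y2].
      by apply: contraNneq ab => E'; rewrite -E -E' edgeK.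
    exact: edge_neq.
  - exact: val_inj.
  - move=> y; apply/codomP/idP => [[[z zA] ->]//|yA].
    by exists (mk _ yA).
  - by rewrite /= edgeK.
  - by rewrite edE edgeK.
  - move=> x; rewrite -!(inj_eq val_inj) edE permE /= /ef => x1 x2.
    by rewrite !edge_eq (negPf x1) (negPf x2).
  - by move=> x; rewrite permE.
  - exact: edgeK.
have /porbitsP[y0 oE] := outer_face K.
have conn := (sdv_connected sd).2 (@dart_connected K).
have eul : #|porbits n| + #|porbits (e * n)%g| = #|porbits e| + 2.
  by apply/eqP; rewrite -(sdv_euler sd) euler_formula.
(* The dart [y0] of the outer face may be one of the removed darts; its retract is a remaining dart
   of the same face. *)
pose H := PlaneGraph (sdv_eK sd) (sdv_en sd) conn eul
  (porbit_mem_porbits (e * n)%g (sdv_retract e val d b y0)).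
exists H, val, d; split=> //; split; first exact: val_inj.
exists a, b; split=> //.
- exact: sdv_codom sd.
- split; [exact: sdv_ed sd|exact: sdv_eed sd|].
  by move=> x; rewrite edge_ofE !inE negb_or => /andP[]; apply: (sdv_e sd).
- by split=> //; exact: sdv_n sd.
move=> x; rewrite oE !porbit_in -(sdv_porbit_retract sd y0).
by apply/eqP/eqP => /(sdv_porbit_face sd).
Qed.

(** * Unshared edges of a face and the steps that lower the defect *)

Section Windows.
Variable G : plane_graph.
Implicit Types d x y z : G.
Hypothesis hG : cers_darts G.

Let bl : bridgeless G. Proof. by case: hG. Qed.
Let deg : degree23 G. Proof. by case: hG. Qed.
Let tri : dual_triangle_free G.
Proof. by case: hG => _ _ _ _ /tree_triangle_free. Qed.

Lemma unshared_inner x : x \notin outer G -> ~~ shared x = (edge G x \in outer G).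
Proof. by move=> xO; rewrite /shared xO negbK. Qed.

Lemma exists_unshared x : x \notin outer G ->
  exists2 d, face_of d = face_of x & edge G d \in outer G.
Proof.
move=> xO; case: (boolP (shared x)) => shx; last first.
  by exists x; rewrite // -unshared_inner.
by exists (face G x); [rewrite face_of_face|apply: outer_after_shared].
Qed.

(** A third dart at the vertex would have the outer face on both sides. *)
Lemma degree2_between_unshared x : edge G x \in outer G ->
  edge G (face G x) \in outer G -> node G (face G x) = edge G x.
Proof.
move=> exO efxO; have [_ [[]|n3]] := deg (edge G x); first by rewrite -faceE.
rewrite -faceE in n3; set r := node G (face G x) in n3.
have rO : face_of r = outer G by apply/eqP; rewrite face_of_node -outerE.
have erO : face_of (edge G r) = outer G.
  by apply/eqP; rewrite -face_of_node n3 -outerE.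
by have := bl r; rewrite rO erO eqxx.
Qed.

(* If every window of three darts meets the shared ones, these make up at     *)
(* least a third of the face, and even half of it if they have one colour.    *)
Lemma three_unshared (c : G -> bool) x0 : dart_coloring c -> normal_darts c ->
  x0 \notin outer G -> 6 < #|face_of x0| ->
  exists x, [/\ face_of x = face_of x0, edge G x \in outer G,
                edge G (face G x) \in outer G
              & edge G (face G (face G x)) \in outer G].
Proof.
move=> hc nd x0O N6; pose f := face G; pose S := shared_of x0.
have [S3 reg] := nd _ x0O; rewrite -/S in S3 reg.
have cpre (A : {set G}) : #|f @^-1: A| = #|A|.
  by rewrite card_preimset //; apply: perm_inj.
pose W x := [&& face_of x == face_of x0, ~~ shared x, ~~ shared (f x) & ~~ shared (f (f x))].
have [x /and4P[/eqP fx h1 h2 h3]|noW] := pickP W.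
  have xO : x \notin outer G by rewrite (outer_of fx).
  exists x; rewrite -!unshared_inner ?outer_face_dart //.
exfalso; have win x : face_of x = face_of x0 -> [|| x \in S, f x \in S | f (f x) \in S].
  move=> fx; have := noW x; rewrite /W fx eqxx /=.
  have inS z : face_of z = face_of x0 -> (z \in S) = shared z.
    by move=> fz; rewrite inE porbit_in -!/(face_of _) fz eqxx.
  rewrite !inS ?face_of_face //.
  by case: (shared x); case: (shared (f x)); case: (shared (f (f x))).
have inF z : (z \in face_of x0) = (face_of z == face_of x0) by rewrite porbit_in.
have big (A : {set G}) m : face_of x0 \subset A -> #|A| <= m -> m <= 6 -> False.
  move=> /subset_leq_card h1 h2 h3; have := leq_trans (leq_trans h1 h2) h3.
  by rewrite leqNgt N6.
(* With at most two shared darts, [S] and its two shifts cover the face by at most six darts. *)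
have [S2|S2] := leqP #|S| 2.
  apply: (big (S :|: f @^-1: S :|: f @^-1: (f @^-1: S)) (2 + 2 + 2)) => //.
    by apply/subsetP => z; rewrite inF => /eqP/win; rewrite !inE -!orbA.
  apply: leq_trans (leq_card_setU _ _) _; rewrite !cpre.
  by apply: leq_add => //; apply: leq_trans (leq_card_setU _ _) _; rewrite cpre leq_add.
have S3' : #|S| = 3 by apply/eqP; rewrite eqn_leq S3.
have mono : {in S &, forall y z, c y = c z}.
  move=> y z yS zS; have [->//|yz] := eqVneq y z.
  have [w] : exists w, w \in S :\ y :\ z.
    apply/set0Pn; rewrite -card_gt0; have := S3'.
    rewrite (cardsD1 y) yS (cardsD1 z) in_setD1 [z == y]eq_sym yz zS /=.
    by rewrite !add1n => -[->].
  rewrite !in_setD1 => /and3P[wz wy wS]; apply: (reg y z w) => //.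
  - by rewrite eq_sym.
  - by rewrite eq_sym.
have [y0 y0S] : exists y0, y0 \in S by apply/set0Pn; rewrite -card_gt0 S3'.
(* In the window centred at [z] the outer two darts have the colour opposite to that of [S], so [z]
   must be the shared one. Then [S] and one shift already cover the face. *)
have good z : face_of z = face_of x0 -> c z = c y0 -> z \in S.
  move=> fz cz; pose w := (face G)^-1%g z; have wz : f w = z by rewrite /f permKV.
  have := win w; rewrite wz -(face_of_face w) -/f wz fz => /(_ (erefl _)).
  have cw : c w = ~~ c y0 by rewrite -cz -wz (coloring_face hc) negbK.
  have cf : c (f z) = ~~ c y0 by rewrite (coloring_face hc) cz.
  case/or3P=> // h; first by have := mono _ _ h y0S; rewrite cw; case: (c y0).
  by have := mono _ _ h y0S; rewrite cf; case: (c y0).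
apply: (big (S :|: f @^-1: S) (3 + 3)) => //; last first.
  by apply: leq_trans (leq_card_setU _ _) _; rewrite cpre leq_add.
apply/subsetP => z; rewrite inF => /eqP fz; apply/setUP.
case: (eqVneq (c z) (c y0)) => cz; [by left; apply: good|right].
have fzS : f z \in S; last by rewrite inE.
apply: good; first by rewrite face_of_face.
by rewrite (coloring_face hc); move: cz; case: (c z); case: (c y0).
Qed.

(** The face has an unshared edge because no two consecutive edges are shared. Its size grows by two
    to at most 6, so the defect falls by two. *)
Lemma subdivide_step x : x \notin outer G -> #|face_of x| <= 4 ->
  exists K : plane_graph,
    [/\ cers K, transformation1 G K & total_defect K < total_defect G].
Proof.
move=> xO N4; have [d fd edO] := exists_unshared xO.
have dO : d \notin outer G by rewrite (outer_of fd).
have [H [phi s1]] := exists_subdivision d.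
have [K [psi s2]] := exists_subdivision (phi d).
exists K; split.
- by apply/cersP; apply: (double_cers s1 s2).
- left; exists 2, (segment_at d), (push_edges psi (push_edges phi (segment_at d))).
  split=> //; first exact: segment_at_boundary.
  apply: (SubdivisionsS (d := phi d)) s2.
    apply: (SubdivisionsS (d := d)) s1; first exact: Subdivisions0.
    exact: segment_at_id.
  by apply: imset_f; case: (edge_of_cover (segment_at_id d)).
have := double_total_defect s1 s2 dO edO; rewrite fd /hexagon_defect.
move: N4; move: #|face_of x| (total_defect K) (total_defect G) => N k g.
lia.
Qed.

(** The two vertices between three consecutive unshared edges have degree 2 and are smoothed. The
    size falls by two to at least 6, which lowers the defect and rules out the digon of
    [double_cers_inv]. *)
Lemma smooth_step (c : G -> bool) x0 : dart_coloring c -> normal_darts c ->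
  x0 \notin outer G -> 7 < #|face_of x0| ->
  exists K : plane_graph,
    [/\ cers K, transformation1 G K & total_defect K < total_defect G].
Proof.
move=> hc nd x0O N7; have [x [fx exO efxO effxO]] := three_unshared hc nd x0O (ltnW N7).
have xO : x \notin outer G by rewrite (outer_of fx).
have fxO : face G x \notin outer G by rewrite outer_face_dart.
have ffxO : face G (face G x) \notin outer G by rewrite outer_face_dart.
have N : 7 < #|face_of x| by rewrite fx.
have inj i j : i < 8 -> j < 8 -> iter i (face G) x = iter j (face G) x -> i = j.
  by move=> i8 j8; apply: iter_porbit_inj; apply: leq_trans N.
have [] := @exists_smoothing G (edge G x) (face G x).
- by apply: contraNneq fxO => <-.
- by rewrite edgeK; apply/eqP => /(inj 0 1 isT isT).
- by rewrite faceE.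
- exact: degree2_between_unshared.
move=> H [psi [d2 [s2 d2E]]]; rewrite edgeK in d2E.
have [a [b sd2]] := subdivision_sdv s2.
have aE : a = edge G x by rewrite -(sdv_ed sd2) d2E.
have bE : b = face G x by rewrite -(sdv_na sd2) aE faceE.
have ed2 : psi (edge H d2) = edge G (face G x).
  by apply: (@edge_inj G); rewrite (sdv_eed sd2) edgeK bE.
have fd2 : psi (face H d2) = face G (face G x) by rewrite -(sdv_fb sd2) bE.
have injp := sdv_inj sd2.
(* The second vertex lies between the merged edge of [d2] and the third unshared edge. *)
have [] := @exists_smoothing H (edge H d2) (face H d2).
- by apply: contraNneq ffxO => E; rewrite -fd2 -E ed2.
- rewrite edgeK; apply/eqP => E; have := congr1 psi E; rewrite fd2 d2E.
  by move=> /(inj 0 2 isT isT).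
- by rewrite faceE.
- apply: injp; rewrite -(sdv_n sd2) fd2 ed2.
  exact: degree2_between_unshared.
move=> K [phi [d [s1 dE]]]; rewrite edgeK in dE; rewrite -dE in s2.
exists K.
have dO : d \notin outer K.
  by rewrite -(subdivision_outer s1) dE -(subdivision_outer s2) d2E.
have edO : edge K d \in outer K.
  by rewrite -(subdivision_outer_edge s1) -(subdivision_outer_edge s2) dE d2E.
have cF : #|face_of x| = #|face_of d| + 2.
  rewrite -d2E -dE (double_card_face s1 s2 edO) porbit_id porbit_in -!/(face_of _).
  suff -> : (face_of (edge K d) == face_of d) = false by [].
  by apply/eqP => E; rewrite (outer_of E) (negPf dO) in edO.
split.
- apply/cersP; apply: (double_cers_inv s1 s2) => //.
  by move: N; rewrite cF; lia.
(* Read backwards, [G] arises from [K] by two subdivisions of one edge. The segment of [x] contains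
   all three edges, so pulling [Q] back twice and pushing it forward again returns [Q]. *)
- right; pose Q := segment_at x.
  have Qx : edge_of x \in Q := segment_at_id x.
  have ne i : i < 7 -> edge_of (iter i (face G) x) != edge_of (iter i.+1 (face G) x).
    move=> i7; apply/eqP => /(face_edge_of_inj bl); rewrite !face_of_iter.
    by move=> /(_ (erefl _)) /(inj i i.+1 (ltnW i7) i7) /eqP; rewrite ltn_eqF.
  have Qfx : edge_of (face G x) \in Q by apply: segment_at_next => //; apply: (ne 0).
  have Qffx : edge_of (face G (face G x)) \in Q.
    by apply: segment_at_next; rewrite ?face_of_face //; apply: (ne 1).
  have QE : Q \subset edges G.
    apply/subsetP => e; rewrite inE => /connectP[p]; case/lastP: p => [|p t].
      by move=> _ ->; apply: porbit_mem_porbits.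
    rewrite rcons_path last_rcons => /andP[_ /and3P[_ _ /and4P[_ tE _ _]]] -> //.
  pose Q1 := pull_edges psi Q; pose P := pull_edges phi Q1.
  have pQ1 : push_edges psi Q1 = Q.
    by apply: (push_pull_edges s2) => //; rewrite dE ?d2E ?ed2 ?edge_of_edge.
  have inQ1 (z : H) : edge_of (psi z) \in Q -> edge_of z \in Q1.
    by move=> zQ; apply: imset_f; rewrite inE.
  have [a1 [b1 sd1]] := subdivision_sdv s1.
  have a1E : a1 = edge H d2 by rewrite -(sdv_ed sd1) dE.
  have b1E : b1 = face H d2 by rewrite -(sdv_na sd1) a1E faceE.
  have pQ : push_edges phi P = Q1.
    apply: (push_pull_edges s1).
    - by apply/subsetP => _ /imsetP[z _ ->]; apply: porbit_mem_porbits.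
    - by apply: inQ1; rewrite dE d2E.
    - by rewrite -(sdv_eb sd1) b1E edge_of_edge; apply: inQ1; rewrite fd2.
  exists 2, P, Q; split=> //; first exact: segment_at_boundary.
  rewrite -pQ1; apply: (SubdivisionsS (d := phi d)) s2; last first.
    by apply: inQ1; rewrite dE d2E.
  rewrite -pQ; apply: (SubdivisionsS (d := d)) s1; first exact: Subdivisions0.
  by apply: imset_f; rewrite inE; apply: inQ1; rewrite dE d2E.
have := double_total_defect s1 s2 dO edO.
by move: N; rewrite cF /hexagon_defect; lia.
Qed.
End Windows.

(** Induction on the total defect; [transformation1_normal] restores the normality that the next
    step needs. As face sizes are even, a size other than 6 is at most 4 or at least 8. *)
Lemma normal_obtained_benzenoid (G : plane_graph) : cers G -> normal_cers G ->
  exists H : plane_graph, catacondensed_benzenoid H /\ obtained_from H G.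
Proof.
have [m] := ubnP (total_defect G); elim: m G => // m IH G hm hG nG.
have cG := (cersP G).1 hG; have [c hc] := cers_coloring cG.
have ndG := (normal_cersP cG hc).1 nG.
have next K : cers K -> transformation1 G K -> total_defect K < total_defect G ->
    exists H : plane_graph, catacondensed_benzenoid H /\ obtained_from H G.
  move=> hK tK lK; have nK := (transformation1_normal hG hK tK).1 nG.
  have [|H [bH oH]] := IH K _ hK nK; first exact: leq_trans lK hm.
  by exists H; split=> //; apply: rt_trans oH; apply: rt_step.
have [/forall_inP h6|] := boolP [forall F in inner_faces G, #|F| == 6].
  exists G; split; last exact: rt_refl.
  by split=> // F /h6/eqP.
rewrite negb_forall_in => /exists_inP[F /inner_facesP[x xO ->] n6].
have ev : ~~ odd #|face_of x| by case: cG.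
have [N6|N6] := leqP #|face_of x| 6.
  have [|K [hK tK lK]] := subdivide_step cG xO; last exact: next tK lK.
  by move: ev n6 N6; case: #|face_of x| => [|[|[|[|[|[|[|]]]]]]].
have [|K [hK tK lK]] := smooth_step cG hc ndG xO; last exact: next tK lK.
by rewrite ltn_neqAle N6 andbT; apply: contraNneq ev => <-.
Qed.

Theorem theorem5p2 (G : plane_graph) (hG : cers G) :
  normal_cers G <->
  exists H : plane_graph,
    catacondensed_benzenoid H /\ resonantly_equivalent G H.
Proof.
split=> [nG|[H [bH [oH|oG]]]].
- have [H [bH oH]] := normal_obtained_benzenoid hG nG.
  by exists H; split=> //; left.
- exact/(obtained_from_normal oH)/catacondensed_benzenoid_normal.
- exact/(obtained_from_normal oG)/catacondensed_benzenoid_normal.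
Qed.
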